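(* Let $R=k[X_1,\ldots,X_n]$ be a standard graded polynomial ring over a field $k$ of characteristic $0$. Let $f_1,\ldots,f_{N+1}\in R$ be homogeneous polynomials, with $d_i=\deg(f_i)$ for $i=1,\ldots,N+1$, such that $f_1,\ldots,f_N$ form a regular sequence and such that the ideal $I=(f_1,\ldots,f_{N+1})$ is an almost complete intersection of height $N$ minimally generated by $f_1,\ldots,f_{N+1}$. Then the multiplicity $e(R/I)$ of $R/I$ satisfies \[ e(R/I)\ \leq\ \prod_{i=1}^N d_i - \max\left\{ 1,\ \sum_{i=1}^N (d_i-1) - (d_{N+1}-1) \right\}. \]
   Context: The ring $R=k[X_1,\ldots,X_n]$ is graded with $\deg X_i=1$. Given forms (homogeneous polynomials) $f_1,\ldots,f_N$ in $R$ generating an ideal of height $N$ (equivalently, forming a regular sequence), and a further form $f_{N+1}$ which is a zero-divisor on $R/(f_1,\ldots,f_N)$ in the sense that $(f_1,\ldots,f_N)\subsetneq (f_1,\ldots,f_N):f_{N+1}\subsetneq R$, the ideal $I=(f_1,\ldots,f_{N+1})$ is called an almost complete intersection. In particular $I$ is a proper homogeneous ideal of height $N$. ''Minimally generated by $f_1,\ldots,f_{N+1}$'' means that these forms are a minimal system of generators of $I$. For a homogeneous ideal $J$, $e(R/J)$ denotes the (Hilbert–Samuel) multiplicity of the graded ring $R/J$ with respect to its homogeneous maximal ideal. *)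

(* Defs.v *)
From HB Require Import structures.
From mathcomp Require Import all_boot all_order all_algebra.
From mathcomp Require Import mpoly.

Set Implicit Arguments.
Unset Strict Implicit.
Unset Printing Implicit Defensive.

Import GRing.Theory.
Local Open Scope ring_scope.

(* Ideals are Prop-valued predicates, compared extensionally: no decidability
   of membership is assumed (ring_quotient's idealr is boolean and proper). *)
Section Ideals.
Variable A : comNzRingType.
Implicit Types (I J P : A -> Prop) (a b : A).

Definition is_ideal I : Prop :=
  [/\ I 0, forall a b, I a -> I b -> I (a + b) & forall a b, I b -> I (a * b)].

Definition is_prime P : Prop :=
  [/\ is_ideal P, ~ P 1 & forall a b, P (a * b) -> P a \/ P b].

Definition unit_ideal : A -> Prop := fun _ => True.

Definition ideal_sub I J : Prop := forall a, I a -> J a.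

Definition ideal_proper I J : Prop := ideal_sub I J /\ ~ ideal_sub J I.

(* The ideal generated by the f i with S i. *)
Definition ideal_gen m (f : 'I_m -> A) (S : pred 'I_m) : A -> Prop :=
  fun a => exists c : 'I_m -> A, a = \sum_(i | S i) c i * f i.

Definition ideal_add I J : A -> Prop :=
  fun a => exists b c, [/\ I b, J c & a = b + c].

Definition ideal_mul I J : A -> Prop :=
  fun a => exists r (b c : 'I_r -> A),
    (forall i, I (b i) /\ J (c i)) /\ a = \sum_i b i * c i.

Definition ideal_exp I (s : nat) : A -> Prop :=
  iter s (ideal_mul I) unit_ideal.

(* I : (b) *)
Definition ideal_colon I b : A -> Prop := fun a => I (a * b).

Definition regular_sequence m (f : 'I_m -> A) : Prop :=
  (forall (i : 'I_m) a,
      ideal_gen f [pred j : 'I_m | (j < i)%N] (a * f i) ->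
      ideal_gen f [pred j : 'I_m | (j < i)%N] a) /\
  ~ ideal_gen f predT 1.

Definition minimal_generators m (f : 'I_m -> A) : Prop :=
  forall S : {set 'I_m}, S \proper [set: 'I_m] ->
    ideal_proper (ideal_gen f (mem S)) (ideal_gen f predT).

Definition prime_chain P (h : nat) : Prop :=
  exists Q : nat -> A -> Prop,
    [/\ forall i, (i <= h)%N -> is_prime (Q i),
        forall i, (i < h)%N -> ideal_proper (Q i) (Q i.+1) & Q h = P].

Definition prime_height P (h : nat) : Prop :=
  prime_chain P h /\ forall h', prime_chain P h' -> (h' <= h)%N.

(* Infimum of the heights of the primes containing I; primes of infinite
   height, which have no h' with prime_height P h', play no role in it. *)
Definition ideal_height I (h : nat) : Prop :=
  (exists P, [/\ is_prime P, ideal_sub I P & prime_height P h]) /\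
  forall P h', is_prime P -> ideal_sub I P -> prime_height P h' -> (h <= h')%N.

(* The submodules of A / J are the ideals containing J, so the length of A / J
   is the supremum of the lengths of strict chains of such ideals. *)
Definition ideal_chain_above J (l : nat) : Prop :=
  exists C : nat -> A -> Prop,
    (forall i, (i <= l)%N -> is_ideal (C i) /\ ideal_sub J (C i)) /\
    forall i, (i < l)%N -> ideal_proper (C i) (C i.+1).

Definition quotient_length J (l : nat) : Prop :=
  ideal_chain_above J l /\ forall l', ideal_chain_above J l' -> (l' <= l)%N.

(* With B = A / J, the quotient B / M^(t+1) B is A / (J + M^(t+1)). *)
Definition hilbert_samuel_poly (M J : A -> Prop) (p : {poly rat}) : Prop :=
  exists t0 : nat, forall t : nat, (t0 <= t)%N ->
    exists l : nat,
      quotient_length (ideal_add J (ideal_exp M t.+1)) l /\ p.[t%:R] = l%:R.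

End Ideals.

Section GradedPolynomialRing.
Variables (k : fieldType) (n : nat).
Notation R := {mpoly k[n]}.

Definition irrelevant_ideal : R -> Prop :=
  ideal_gen (fun i : 'I_n => 'X_i : R) predT.

(* e(R/J) = e: if p is the Hilbert-Samuel polynomial of R/J, of degree D (which
   is dim R/J), then e is D! times the leading coefficient of p.  The polynomial
   p is unique, hence so is e; p = 0 and e = 0 when J = R. *)
Definition multiplicity (J : R -> Prop) (e : rat) : Prop :=
  exists p : {poly rat},
    hilbert_samuel_poly irrelevant_ideal J p /\
    e = ((size p).-1)`!%:R * lead_coef p.

Definition init_family N (f : 'I_N.+1 -> R) : 'I_N -> R :=
  fun i => f (widen_ord (leqnSn N) i).

Definition almost_complete_intersection N (f : 'I_N.+1 -> R) : Prop :=
  let c := ideal_gen (init_family f) predT in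
  [/\ forall i, exists d, f i \is d.-homog,
      ideal_height c N,
      ideal_proper c (ideal_colon c (f ord_max)) &
      ideal_proper (ideal_colon c (f ord_max)) (@unit_ideal R)].

End GradedPolynomialRing.

(* Main.v *)
(* Let c = (f_1, ..., f_N), f = f_{N+1}, s = sum (d_i - 1) and D = n - N.  The
   Hilbert function of R/c is known, and that of R/I is obtained by subtracting
   the one of R/(c : f), shifted by deg f.  So it suffices to bound the Hilbert
   function of R/(c : f) from below by the coefficients of
   (1 + z + ... + z^(s - deg f)) / (1 - z)^D whenever f is a form outside c.
   For D = 0 this holds because the socle of R/c lives in degree s only, so that
   f has nonzero multiples in all degrees from deg f to s.  For D > 0 one cuts by
   a linear form l regular modulo c, after dividing f by the largest power of l
   that divides it modulo c.
   The socle degree is computed by exchanging the f_i one by one for linear forms,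
   and the existence of l follows from prime avoidance and the absence of a socle.
   Finally R/I has dimension exactly D, since I is contained in c : g for a form g
   outside c with f g in c. *)

Require Import Defs.
From HB Require Import structures.
From mathcomp Require Import all_boot all_order all_algebra.
From mathcomp Require Import mpoly.
From mathcomp Require Import zify ring lra.
From Stdlib Require Import Classical ClassicalEpsilon.

Set Implicit Arguments.
Unset Strict Implicit.
Unset Printing Implicit Defensive.

Import Order.TTheory GRing.Theory Num.Theory.
Local Open Scope ring_scope.

(** The subtracted maximum is the number r of terms of 1 + z + ... + z^(s - deg f), with s - deg f
    cut off at 0. Exchanging a form of degree d for a linear form lowers the socle degree by d - 1,
    and a quotient by linear forms with a nonzero socle is k itself, with socle degree 0; hence the
    value s. Division by l is forced because f may vanish modulo (l, c), where the induction on D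
    says nothing. At the end an upper bound on the summed Hilbert function is not enough: the
    normalisation of e depends on the degree of the polynomial, which the lower bound keeps from
    dropping. *)

Section Choice.

(** [Q] sees all earlier terms, because a bad sequence must avoid the ideal generated by everything
    chosen before. *)
Lemma list_dependent_choice (T : Type) (Q : seq T -> T -> Prop) :
  (forall l, exists x, Q l x) -> exists u : nat -> T, forall q, Q (mkseq u q) (u q).
Proof.
move=> exQ.
pose F l := proj1_sig (constructive_indefinite_description _ (exQ l)).
have QF l : Q l (F l) by rewrite /F; case: constructive_indefinite_description.
pose L := fix L q := if q is q'.+1 then rcons (L q') (F (L q')) else [::].
exists (fun q => F (L q)) => q.
suff <- : L q = mkseq (fun q => F (L q)) q by [].
by elim: q => //= q {1}->; rewrite mkseqS.
Qed.

Lemma functional_choice (S T : Type) (Q : S -> T -> Prop) :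
  (forall x, exists y, Q x y) -> exists f : S -> T, forall x, Q x (f x).
Proof.
move=> exQ; exists (fun x => proj1_sig (constructive_indefinite_description _ (exQ x))).
by move=> x; case: constructive_indefinite_description.
Qed.

End Choice.

(** * Ideals generated by finite lists *)

Section ListIdeals.
Variable A : comNzRingType.
Implicit Types (I J : A -> Prop) (a b x : A) (s : seq A).

Lemma ideal0 I : is_ideal I -> I 0. Proof. by case. Qed.

Lemma idealD I a b : is_ideal I -> I a -> I b -> I (a + b).
Proof. by case=> _ + _; apply. Qed.

Lemma idealMl I a b : is_ideal I -> I b -> I (a * b).
Proof. by case=> _ _; apply. Qed.

Lemma idealMr I a b : is_ideal I -> I a -> I (a * b).
Proof. by move=> hI Ia; rewrite mulrC; apply: idealMl. Qed.

Lemma idealN I a : is_ideal I -> I a -> I (- a).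
Proof. by move=> hI Ia; rewrite -mulN1r; apply: idealMl. Qed.

Lemma idealB I a b : is_ideal I -> I a -> I b -> I (a - b).
Proof. by move=> hI Ia Ib; apply: idealD => //; apply: idealN. Qed.

Lemma ideal_sum I (T : Type) (r : seq T) (P : pred T) (F : T -> A) :
  is_ideal I -> (forall i, P i -> I (F i)) -> I (\sum_(i <- r | P i) F i).
Proof.
move=> hI IF; elim/big_ind: _ => //; first exact: ideal0.
by move=> x y; apply: idealD.
Qed.

Lemma ideal_subr I a b : is_ideal I -> I (a - b) -> I b -> I a.
Proof. by move=> hI Iab Ib; rewrite -(subrK b a); apply: idealD. Qed.

(** The recursion removes one generator together with its cofactor, which is how a regular sequence
    is used; [ideal_genE] relates it to [ideal_gen]. *)
Fixpoint gen s a : Prop :=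
  if s is x :: s' then exists b, gen s' (a - b * x) else a = 0.

Lemma gen_ideal s : is_ideal (gen s).
Proof.
elim: s => [|x s [IH0 IHD IHM]] /=.
  by split=> [|a b -> ->|a b ->]; rewrite ?addr0 ?mulr0.
split=> [|a b [a' ha] [b' hb]|a b [b' hb]].
- by exists 0; rewrite mul0r subr0.
- exists (a' + b'); have -> : a + b - (a' + b') * x = (a - a' * x) + (b - b' * x) by ring.
  exact: IHD.
- exists (a * b'); have -> : a * b - a * b' * x = a * (b - b' * x) by ring.
  exact: IHM.
Qed.

Lemma gen_mem s x : x \in s -> gen s x.
Proof.
elim: s => //= y s IH; rewrite inE => /orP[/eqP->|/IH hx].
  by exists 1; rewrite mul1r subrr; apply: ideal0 (gen_ideal s).
by exists 0; rewrite mul0r subr0.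
Qed.

Lemma gen_min s I a :
  is_ideal I -> (forall x, x \in s -> I x) -> gen s a -> I a.
Proof.
move=> hI; elim: s a => [|x s IH] a /= hs; first by move=> ->; apply: ideal0.
case=> b hb; apply: (@ideal_subr _ _ (b * x)) => //.
  by apply: IH hb => y hy; apply: hs; rewrite inE hy orbT.
by apply: idealMl => //; apply: hs; rewrite mem_head.
Qed.

Lemma gen_subset s1 s2 a : {subset s1 <= s2} -> gen s1 a -> gen s2 a.
Proof.
by move=> hs; apply: gen_min (gen_ideal s2) _ => x /hs; apply: gen_mem.
Qed.

Lemma gen_eqmem s1 s2 a : s1 =i s2 -> gen s1 a <-> gen s2 a.
Proof. by move=> hs; split; apply: gen_subset => x; rewrite hs. Qed.

Lemma gen_cons x s a : gen s a -> gen (x :: s) a.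
Proof. by exists 0; rewrite mul0r subr0. Qed.

Lemma colon_ideal I b : is_ideal I -> is_ideal (ideal_colon I b).
Proof.
move=> hI; rewrite /ideal_colon; split=> [|x y hx hy|x y hy].
- by rewrite mul0r; apply: ideal0.
- by rewrite mulrDl; apply: idealD.
- by rewrite -mulrA; apply: idealMl.
Qed.

End ListIdeals.

(** * Noetherian rings and zero-divisors *)

Section Noetherian.

(* Noetherianity stated on sequences, so that no chain of ideals has to be
   handled. *)
Definition noetherian (A : comNzRingType) : Prop :=
  forall u : nat -> A, exists q, gen (mkseq u q) (u q).

Lemma noetherian_field (k : fieldType) : noetherian k.
Proof.
move=> u; have [u0|u0] := eqVneq (u 0%N) 0; first by exists 0%N.
by exists 1%N; exists (u 1%N / u 0%N); rewrite /= divfK ?subrr.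
Qed.

Lemma noetherian_surj (A B : comNzRingType) (f : {rmorphism A -> B}) :
  (forall b, exists a, f a = b) -> noetherian A -> noetherian B.
Proof.
move=> f_surj nA u; have [g fg] := functional_choice f_surj.
have [q hq] := nA (g \o u); exists q.
have gen_f s a : gen s a -> gen (map f s) (f a).
  elim: s a => [|x s IH] a /=; first by move->; rewrite rmorph0.
  by case=> b /IH hb; exists (f b); rewrite -rmorphM -rmorphB.
move: (gen_f _ _ hq); rewrite -map_comp /= fg.
by rewrite (@eq_map _ _ _ u) // => i /=; rewrite fg.
Qed.

(** Multiplying each nonzero generator by a power of X brings it to size [m], where leading
    coefficients can be combined. The conclusion names the coefficient of index [m.-1] since [c] may
    vanish. *)
Lemma gen_lead_coef (A : comNzRingType) (s : seq {poly A}) (m : nat) (c : A) :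
  (forall p, p \in s -> (size p <= m)%N) -> gen (map lead_coef s) c ->
  exists r, [/\ gen s r, (size r <= m)%N & r`_m.-1 = c].
Proof.
elim: s c => [|x s IH] c /= hs.
  by move->; exists 0; rewrite size_poly0 coef0.
case=> b /IH[|r [gr sr rm]]; first by move=> p hp; apply: hs; rewrite inE hp orbT.
have sx : (size x <= m)%N by apply: hs; rewrite mem_head.
exists (r + b *: 'X^(m - size x) * x); split.
- by exists (b *: 'X^(m - size x)); rewrite addrK.
- rewrite (leq_trans (size_polyD _ _)) // geq_max sr /= -scalerAl.
  rewrite (leq_trans (size_scale_leq _ _)) // mulrC.
  have [->|x0] := eqVneq x 0; first by rewrite mul0r size_poly0.
  by rewrite size_mulXn // subnK.
- rewrite coefD rm -scalerAl coefZ coefXnM.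
  have [->|x0] := eqVneq x 0; first by rewrite lead_coef0 coef0 if_same !mulr0 subr0 addr0.
  have sx0 : (0 < size x)%N by rewrite size_poly_gt0.
  have -> : (m.-1 < m - size x)%N = false by lia.
  have -> : (m.-1 - (m - size x) = (size x).-1)%N by lia.
  by rewrite -lead_coefE subrK.
Qed.

Lemma mkseq_subset (T : eqType) (u : nat -> T) i j :
  (i <= j)%N -> {subset mkseq u i <= mkseq u j}.
Proof.
move=> ij x /mapP[m]; rewrite mem_iota add0n => /andP[_ mi] ->.
by apply/mapP; exists m; rewrite // mem_iota add0n (leq_trans mi ij).
Qed.

Lemma mem_mkseq (T : eqType) (u : nat -> T) i q : (i < q)%N -> u i \in mkseq u q.
Proof. by move=> iq; apply/mapP; exists i; rewrite // mem_iota. Qed.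

Lemma mkseqP (T : eqType) (u : nat -> T) q x :
  x \in mkseq u q -> exists2 i, (i < q)%N & x = u i.
Proof. by case/mapP=> i; rewrite mem_iota add0n => /andP[_ iq] ->; exists i. Qed.

Lemma ex_minimal_size (A : comNzRingType) (P : {poly A} -> Prop) p :
  P p -> exists2 q, P q & forall r, P r -> (size q <= size r)%N.
Proof.
have [m] := ubnP (size p); elim: m p => // m IH p; rewrite ltnS => pm Pp.
case: (classic (exists2 r, P r & (size r < size p)%N)) => [[r Pr rp]|no].
  by apply: IH Pr; apply: leq_trans pm.
exists p => // r Pr; rewrite leqNgt; apply/negP => rp; apply: no.
by exists r.
Qed.

(* Hilbert's basis theorem: a bad sequence gives an ideal I that is not finitely
   generated; picking successive elements of I of minimal degree outside the
   ideal of the previous ones, the leading coefficients form a bad sequence. *)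
Lemma noetherian_poly (A : comNzRingType) : noetherian A -> noetherian {poly A}.
Proof.
move=> nA u; apply: NNPP => bad.
pose I p := exists q, gen (mkseq u q) p.
have hI : is_ideal I.
  split=> [|a b [q1 h1] [q2 h2]|a b [q hq]].
  - by exists 0%N.
  - exists (maxn q1 q2); apply: idealD (gen_ideal _) _ _.
      by apply: gen_subset h1; apply/mkseq_subset/leq_maxl.
    by apply: gen_subset h2; apply/mkseq_subset/leq_maxr.
  - by exists q; apply: idealMl (gen_ideal _) hq.
have Inf (l : seq {poly A}) : (forall x, x \in l -> I x) ->
    exists2 p, I p & ~ gen l p.
  move=> hl; have [q hq] : exists q, forall x, x \in l -> gen (mkseq u q) x.
    elim: l hl => [|y l IH] hl; first by exists 0%N.
    have [|q1 h1] := IH; first by move=> x xl; apply: hl; rewrite inE xl orbT.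
    have [q2 h2] := hl y (mem_head _ _).
    exists (maxn q1 q2) => x; rewrite inE => /orP[/eqP->|/h1].
      by apply: gen_subset h2; apply/mkseq_subset/leq_maxr.
    by apply: gen_subset; apply/mkseq_subset/leq_maxl.
  exists (u q); first by exists q.+1; apply/gen_mem/mem_mkseq.
  by move=> hu; apply: bad; exists q; apply: gen_min hu => //; apply: gen_ideal.
pose Q (l : seq {poly A}) p := (forall x, x \in l -> I x) ->
  [/\ I p, ~ gen l p & forall r, I r -> ~ gen l r -> (size p <= size r)%N].
have [v hv] : exists v : nat -> {poly A}, forall q, Q (mkseq v q) (v q).
  apply: list_dependent_choice => l.
  case: (classic (forall x, x \in l -> I x)) => [hl|]; last by exists 0.
  have [p0 Ip0 gp0] := Inf l hl.
  have [p [Ip gp] pmin] := ex_minimal_size (P := fun p => I p /\ ~ gen l p) (conj Ip0 gp0).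
  by exists p => _; split => // r Ir gr; apply: pmin.
have Iv q : I (v q).
  have [m] := ubnP q; elim: m q => // m IH q; rewrite ltnS => qm.
  case: (hv q) => // x /mkseqP[i iq ->]; apply: IH; exact: leq_trans iq qm.
have {}hv q : ~ gen (mkseq v q) (v q) /\
    forall r, I r -> ~ gen (mkseq v q) r -> (size (v q) <= size r)%N.
  by case: (hv q) => // x /mkseqP[i iq ->].
have [q] := nA (lead_coef \o v).
rewrite /mkseq (map_comp lead_coef) -/(mkseq v q) /=.
have [ngv minv] := hv q.
(* Sizes do not decrease along [v]: for i < q, [v q] was itself a candidate when [v i] was
   chosen. *)
case/(@gen_lead_coef _ _ (size (v q))).
  move=> _ /mkseqP[i iq ->]; case: (hv i) => _; apply=> // gi; apply: ngv.
  by apply: gen_subset gi; apply: mkseq_subset; apply: ltnW.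
move=> r [gr sr rlc].
have v0 : v q != 0.
  by apply/eqP => v0; apply: ngv; rewrite v0; apply: ideal0 (gen_ideal _).
have Ir : I r by apply: gen_min gr => // _ /mkseqP[i _ ->].
(* Subtracting [r] cancels the top coefficient, so [v q - r] is smaller than [v q] but still outside
   the earlier ideal. *)
have /minv : I (v q - r) by apply: idealB.
case: (classic (gen (mkseq v q) (v q - r))) => [gvr _|ng /(_ ng)].
  by apply: ngv; apply: ideal_subr gvr gr; apply: gen_ideal.
rewrite leqNgt => /negP; apply.
have s0 : (0 < size (v q))%N by rewrite size_poly_gt0.
rewrite -(prednK s0) ltnS; apply/leq_sizeP => j; rewrite leq_eqVlt => /orP[/eqP<-|hj].
  by rewrite coefB rlc subrr.
have hj' : (size (v q) <= j)%N by rewrite -(prednK s0).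
by rewrite coefB !nth_default ?subrr // (leq_trans sr).
Qed.

Lemma noetherian_mpoly (k : fieldType) n : noetherian {mpoly k[n]}.
Proof.
elim: n => [|n IH].
  apply: (@noetherian_surj k _ (@mpolyC 0 k)); last exact: noetherian_field.
  move=> p; exists p@_0; apply/mpolyP => m.
  by rewrite mcoeffC (_ : m = 0%MM) ?eqxx ?mulr1 //; apply/mnmP; case.
have [f [fC fX]] : exists f : {rmorphism {poly {mpoly k[n]}} -> {mpoly k[n.+1]}},
    (forall c, f c%:P = mwiden c) /\ f 'X = 'X_ord_max.
  exists (horner_eval ('X_ord_max : {mpoly k[n.+1]}) \o map_poly (@mwiden n k)).
  split=> [c|]; rewrite /= ?map_polyC ?map_polyX /= /horner_eval ?hornerC ?hornerX //.
apply: (noetherian_surj (f := f)); last exact: noetherian_poly IH.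
move=> p; rewrite [p]mpolyE.
elim: (msupp p) => [|m s [a fa]]; first by exists 0; rewrite rmorph0 big_nil.
rewrite big_cons -fa.
suff [b <-] : exists b, f b = p@_m *: 'X_[m] by exists (b + a); rewrite rmorphD.
rewrite -mul_mpolyC mpolyXE_id.
have [b fb] : exists b, f b = \prod_(i < n.+1) 'X_i ^+ m i.
  rewrite big_ord_recr /=.
  exists ((\prod_(i < n) 'X_i ^+ m (widen_ord (leqnSn n) i))%:P * 'X ^+ m ord_max).
  rewrite rmorphM rmorphXn fX fC rmorph_prod /=; congr (_ * _).
  by apply: eq_bigr => i _; rewrite rmorphXn /= mwidenX mnmwiden1.
by exists ((p@_m)%:MP%:P * b); rewrite rmorphM fb fC mwidenC.
Qed.

End Noetherian.

(** * Maximal annihilators modulo an ideal *)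

Section Annihilators.
Variables (A : comNzRingType) (nA : noetherian A).
Variables (c : A -> Prop) (hc : is_ideal c).

(** The ideals [ideal_colon c a] obtained this way are the maximal associated primes of A / c, each
    carried by an element [a]. *)
Definition maximal_ann (a : A) : Prop :=
  ~ c a /\ forall b, ~ c b -> ideal_sub (ideal_colon c a) (ideal_colon c b) ->
    ideal_sub (ideal_colon c b) (ideal_colon c a).

(** Otherwise annihilators grow strictly for ever, and an element new at each stage gives a bad
    sequence. *)
Lemma ex_maximal_ann a : ~ c a ->
  exists2 b, maximal_ann b & ideal_sub (ideal_colon c a) (ideal_colon c b).
Proof.
move=> ca; apply: NNPP => nomax.
pose P b := ~ c b /\ ideal_sub (ideal_colon c a) (ideal_colon c b).
have step b : P b -> exists b', P b' /\
    ideal_proper (ideal_colon c b) (ideal_colon c b').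
  case=> cb ab; apply: NNPP => nob; apply: nomax; exists b => //; split=> // d cd bd x dx.
  apply: NNPP => nbx; apply: nob; exists d; split; first by split=> // y /ab /bd.
  by split=> // db; apply: nbx; apply: db.
have [u hu] : exists u : nat -> A, forall q, P (last a (mkseq u q)) ->
    P (u q) /\ ideal_proper (ideal_colon c (last a (mkseq u q))) (ideal_colon c (u q)).
  apply: (list_dependent_choice (Q := fun l b => P (last a l) ->
    P b /\ ideal_proper (ideal_colon c (last a l)) (ideal_colon c b))) => l.
  case: (classic (P (last a l))) => [/step[b hb]|]; last by exists 0.
  by exists b.
have Pu q : P (last a (mkseq u q)).
  by elim: q => [|q /hu[]]; [split | rewrite mkseqS last_rcons].
have asc i : ideal_proper (ideal_colon c (u i)) (ideal_colon c (u i.+1)).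
  by case: (hu i.+1 (Pu i.+1)); rewrite mkseqS last_rcons.
have [x hx] : exists x : nat -> A,
    forall i, ideal_colon c (u i.+1) (x i) /\ ~ ideal_colon c (u i) (x i).
  apply: (functional_choice (Q := fun i y =>
    ideal_colon c (u i.+1) y /\ ~ ideal_colon c (u i) y)) => i.
  case: (asc i) => _ ns.
  apply: NNPP => nox; apply: ns => y hy; apply: NNPP => ny; apply: nox.
  by exists y.
have mono i j : (i <= j)%N -> ideal_sub (ideal_colon c (u i)) (ideal_colon c (u j)).
  move=> /subnK <-; elim: (j - i)%N => // m IH y /IH hy.
  by case: (asc (m + i)%N) => h _; apply: h.
have [q hq] := nA x; case: (hx q) => _; apply.
apply: gen_min hq; first exact: colon_ideal.
by move=> _ /mkseqP[i iq ->]; apply: (mono i.+1) => //; case: (hx i).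
Qed.

(** If [y * a] is not in [c], its annihilator contains that of [a], hence equals it by maximality,
    and it contains [x]. *)
Lemma maximal_ann_prime a x y : maximal_ann a ->
  ideal_colon c a (x * y) -> ideal_colon c a x \/ ideal_colon c a y.
Proof.
case=> ca maxa axy; case: (classic (ideal_colon c a y)) => [|ay]; first by right.
left; apply: (maxa (y * a)) => //.
  by move=> z hz; rewrite /ideal_colon mulrCA; apply: idealMl.
by rewrite /ideal_colon mulrA.
Qed.

(** Multiply one element chosen for each [b]; primality keeps the product outside the annihilator of
    [a]. *)
Lemma maximal_ann_avoid a (l : seq A) : maximal_ann a ->
  (forall b, b \in l -> ~ ideal_sub (ideal_colon c b) (ideal_colon c a)) ->
  exists x, (forall b, b \in l -> ideal_colon c b x) /\ ~ ideal_colon c a x.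
Proof.
move=> maxa; elim: l => [|b l IH] hl.
  by exists 1; split=> //; rewrite /ideal_colon mul1r; case: maxa.
have [|x [hx nx]] := IH; first by move=> d dl; apply: hl; rewrite inE dl orbT.
have [y [hy ny]] : exists y, ideal_colon c b y /\ ~ ideal_colon c a y.
  apply: NNPP => no; apply: (hl b); first exact: mem_head.
  by move=> y hy; apply: NNPP => ny; apply: no; exists y.
exists (x * y); split=> [d|/maximal_ann_prime[]//].
rewrite inE => /orP[/eqP->|/hx hd]; first exact: idealMl (colon_ideal _ hc) hy.
exact: idealMr (colon_ideal _ hc) hd.
Qed.

(** Noetherianity is applied to the elements carrying the annihilators: if [u q] is a combination of
    earlier terms, whatever kills these kills [u q], against [maximal_ann_avoid]. *)
Lemma finite_maximal_ann : exists l : seq A, (forall b, b \in l -> maximal_ann b) /\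
  forall a, maximal_ann a ->
    exists2 b, b \in l & ideal_sub (ideal_colon c a) (ideal_colon c b).
Proof.
apply: NNPP => nofin.
pose Q (l : seq A) a := (forall b, b \in l -> maximal_ann b) -> maximal_ann a /\
  forall b, b \in l -> ~ ideal_sub (ideal_colon c b) (ideal_colon c a).
have [u hu] : exists u : nat -> A, forall q, Q (mkseq u q) (u q).
  apply: list_dependent_choice => l.
  case: (classic (forall b, b \in l -> maximal_ann b)) => [hl|]; last by exists 0.
  apply: NNPP => noa; apply: nofin; exists l; split=> // a maxa.
  apply: NNPP => nob; apply: noa; exists a => _; split=> // b bl ba.
  apply: nob; exists b => //; case: (hl b bl) => _; apply=> //; by case: maxa.
have maxu q : maximal_ann (u q).
  have [m] := ubnP q; elim: m q => // m IH q; rewrite ltnS => qm.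
  case: (hu q) => // _ /mkseqP[i iq ->]; apply: IH; exact: leq_trans iq qm.
have [q hq] := nA u.
have [|x [hx nx]] := @maximal_ann_avoid (u q) (mkseq u q) (maxu q).
  by case: (hu q) => // _ /mkseqP[i iq ->].
apply: nx; rewrite /ideal_colon mulrC.
apply: (gen_min (colon_ideal x hc)) hq => b /hx.
by rewrite /ideal_colon mulrC.
Qed.

(* The zero-divisors modulo c form a finite union of primes colon c b, so it
   suffices to avoid each of these. *)
Lemma eventually_regular (l : nat -> A) :
  (forall b, ~ c b -> exists B, forall t, (B <= t)%N -> ~ c (l t * b)) ->
  exists B, forall t, (B <= t)%N -> forall a, c (a * l t) -> c a.
Proof.
move=> hl; have [s [smax scov]] := finite_maximal_ann.
have [B hB] : exists B, forall t, (B <= t)%N -> forall b, b \in s -> ~ c (l t * b).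
  elim: s smax {scov} => [|b s IH] smax; first by exists 0%N.
  have [|B1 h1] := IH; first by move=> d ds; apply: smax; rewrite inE ds orbT.
  have [|B2 h2] := hl b; first by case: (smax b (mem_head _ _)).
  exists (maxn B1 B2) => t; rewrite geq_max => /andP[t1 t2] d.
  by rewrite inE => /orP[/eqP->|]; [apply: h2|apply: h1].
exists B => t Bt a cal; apply: NNPP => ca.
have [b maxb ab] := ex_maximal_ann ca.
have [d ds bd] := scov b maxb.
by apply: (hB t Bt d ds); apply: bd; apply: ab; rewrite /ideal_colon mulrC.
Qed.

End Annihilators.

(** * Homogeneous ideals and generic linear forms *)

Section HomogeneousIdeals.
Variables (k : fieldType) (n : nat).
Notation R := {mpoly k[n]}.
Implicit Types (c J : R -> Prop) (a b f g : R).

Notation hpart e a := (pihomog mdeg e a).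

Definition homogeneous_ideal c : Prop :=
  is_ideal c /\ forall a e, c a -> c (hpart e a).

Lemma hpart_sum a : a = \sum_(e < msize a) hpart e a.
Proof. exact: pihomog_partitionE. Qed.

Lemma hpart_homog d e a : a \is d.-homog -> hpart e a = if e == d then a else 0.
Proof.
move=> ha; have [->|ne] := eqVneq e d; first exact: pihomog_dE.
by apply: pihomog_ne0 ha; rewrite eq_sym.
Qed.

Lemma hpartM d e a f : f \is d.-homog ->
  hpart e (a * f) = if (d <= e)%N then hpart (e - d) a * f else 0.
Proof.
move=> hf; rewrite {1}[a]hpart_sum mulr_suml raddf_sum /=.
have hi (i : nat) : hpart e (hpart i a * f) = if e == (i + d)%N then hpart i a * f else 0.
  by apply: hpart_homog; apply: dhomogM => //; apply: pihomogP.
under eq_bigr => i _ do rewrite hi.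
case: leqP => [de|de]; last first.
  by rewrite big1 // => i _; case: eqP => // ?; lia.
case: (ltnP (e - d) (msize a)) => hs.
  rewrite (bigD1 (Ordinal hs)) //= subnK // eqxx big1 ?addr0 // => i ne.
  by case: eqP => // E; case/eqP: ne; apply: val_inj => /=; lia.
rewrite big1; last by move=> i _; case: eqP => // E; have := ltn_ord i; lia.
rewrite [hpart _ a]pihomogE big_seq_cond big_pred0 ?mul0r // => m.
apply/negP => /andP[/msize_mdeg_lt + /eqP E]; rewrite E; lia.
Qed.

Lemma hpart_mem c a : homogeneous_ideal c -> (forall e, c (hpart e a)) -> c a.
Proof. by case=> hc _ ha; rewrite [a]hpart_sum; apply: ideal_sum. Qed.

Lemma gen_homogeneous (s : seq R) :
  (forall f, f \in s -> exists d, f \is d.-homog) -> homogeneous_ideal (gen s).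
Proof.
move=> hs; split; first exact: gen_ideal.
elim: s hs => [|f s IH] hs a e /=; first by move->; rewrite raddf0.
case=> b /IH-/(_ _ e) hb.
have [|d hd] := hs f; first exact: mem_head.
exists (if (d <= e)%N then hpart (e - d) b else 0).
move: hb; rewrite raddfB /= (hpartM _ _ hd).
have {}IH : forall g, g \in s -> exists d, g \is d.-homog.
  by move=> g gs; apply: hs; rewrite inE gs orbT.
by case: ifP => _; rewrite ?mul0r; apply.
Qed.

Lemma colon_homogeneous c f d :
  homogeneous_ideal c -> f \is d.-homog -> homogeneous_ideal (ideal_colon c f).
Proof.
case=> hc ch hf; split; first exact: colon_ideal.
move=> a e; rewrite /ideal_colon => caf.
by have := ch _ (e + d)%N caf; rewrite (hpartM _ _ hf) leq_addl addnK.
Qed.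

Lemma homogX i : ('X_i : R) \is 1.-homog.
Proof. by rewrite dhomogX /= mdeg1. Qed.

Lemma homog_mem_irrelevant J f d :
  is_ideal J -> (forall i, J 'X_i) -> f \is d.-homog -> (0 < d)%N -> J f.
Proof.
move=> hJ JX /dhomogP hf d0; rewrite [f]mpolyE big_seq; apply: ideal_sum => // m /hf mf.
have /existsP[i mi] : [exists i, m i != 0%N].
  rewrite -negb_forall; apply/negP => /forallP m0; move: d0.
  by rewrite -mf /= mdegE big1 // => i _; apply/eqP.
rewrite -mul_mpolyC; apply: idealMl => //.
rewrite -(submK (m := U_(i)) (m' := m)) ?mpolyXD; last first.
  by apply/mnm_lepP => j; rewrite mnm1E; case: eqP => // <-; rewrite lt0n.
exact: idealMl.
Qed.

Definition has_no_socle c : Prop :=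
  forall a e, a \is e.-homog -> (forall i, c ('X_i * a)) -> c a.

(** A form of positive degree is a combination of the variables, so [f] kills every socle
    element. *)
Lemma regular_has_no_socle c f d :
  is_ideal c -> f \is d.-homog -> (0 < d)%N -> (forall a, c (a * f) -> c a) ->
  has_no_socle c.
Proof.
move=> hc hf d0 freg a e _ aX; apply: freg; rewrite mulrC.
exact: (homog_mem_irrelevant (colon_ideal a hc) aX hf d0).
Qed.

(* The linear forms on the moment curve: any n of them span all linear forms
   in characteristic 0. *)
Definition moment_form (t : nat) : R := \sum_(i < n) (t%:R ^+ i) *: 'X_i.

Lemma moment_form_homog t : moment_form t \is 1.-homog.
Proof. by apply: rpred_sum => i _; apply/rpredZ/homogX. Qed.

Lemma moment_form_span (hk : [pchar k] =i pred0) J :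
  is_ideal J -> (forall B, exists2 t, (B <= t)%N & J (moment_form t)) ->
  forall i, J 'X_i.
Proof.
move=> hJ hB i.
have [g hg] : exists g : nat -> nat, forall B, (B <= g B)%N /\ J (moment_form (g B)).
  by apply: (functional_choice (Q := fun B t => (B <= t)%N /\ J (moment_form t)))
    => B; have [t] := hB B; exists t.
pose ts := fix ts j := if j is j'.+1 then g (ts j').+1 else g 0%N.
have Jts j : J (moment_form (ts j)) by case: j => [|j] /=; apply hg.
have tsS j : (ts j < ts j.+1)%N by case: (hg (ts j).+1).
pose V := Vandermonde n (\row_(j < n) (ts j)%:R : 'rV[k]_n).
(* In characteristic 0 the distinct integers [ts j] remain distinct in [k], so the Vandermonde
   determinant is nonzero. *)
have /mulmxV/matrixP V1 : V \in unitmx.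
  rewrite unitmxE det_Vandermonde unitfE; apply/prodf_neq0 => x _.
  apply/prodf_neq0 => y xy; rewrite !mxE.
  have lt : (ts x < ts y)%N by apply: (homo_ltn ltn_trans tsS).
  by rewrite -natrB ?(ltnW lt) // (proj1 (pcharf0P k) hk) subn_eq0 -ltnNge.
have -> : 'X_i = \sum_j (invmx V j i)%:MP * moment_form (ts j) :> R.
  under eq_bigr => j _ do rewrite mul_mpolyC scaler_sumr.
  rewrite exchange_big /= (eq_bigr (fun l : 'I_n => (l == i)%:R *: ('X_l : R))); last first.
    move=> l _; have := V1 l i; rewrite !mxE => <-; rewrite scaler_suml.
    by apply: eq_bigr => j _; rewrite scalerA !mxE mulrC.
  by rewrite (bigD1 i) //= eqxx scale1r big1 ?addr0 // => l /negbTE->; rewrite scale0r.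
by apply: ideal_sum => // j _; apply: idealMl.
Qed.

(** An element killed modulo [c] by moment forms of arbitrarily large parameter is killed by all
    variables; its homogeneous parts are then too, so they lie in [c]. This is the criterion of
    [eventually_regular]. *)
Lemma eventually_regular_form (hk : [pchar k] =i pred0) c :
  homogeneous_ideal c -> has_no_socle c ->
  exists B, forall t, (B <= t)%N -> forall a, c (a * moment_form t) -> c a.
Proof.
move=> hom nosoc; have [hc ch] := hom.
apply: (eventually_regular (@noetherian_mpoly k n)) => // b cb.
apply: NNPP => noB; apply: cb.
have cX i : c ('X_i * b).
  apply: (moment_form_span hk (colon_ideal b hc)) => B; apply: NNPP => not.
  by apply: noB; exists B => t Bt ct; apply: not; exists t.
apply: (hpart_mem hom) => e; apply: (nosoc _ e); first exact: pihomogP.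
move=> i; have := ch _ e.+1 (cX i).
by rewrite mulrC (hpartM _ _ (homogX i)) subn1 mulrC.
Qed.

End HomogeneousIdeals.

(** * Socles modulo regular sequences of forms *)

Section RegularSequences.
Variables (k : fieldType) (n : nat).
Notation R := {mpoly k[n]}.
Implicit Types (c J : R -> Prop) (a b f g : R) (s F L : seq (nat * R)).

Notation hpart e a := (pihomog mdeg e a).

Lemma linear_form_sum f : f \is 1.-homog -> f = \sum_(i < n) f@_U_(i) *: 'X_i.
Proof.
move=> /dhomogP hf; apply/mpolyP => m; rewrite raddf_sum /=.
case: (boolP (mdeg m == 1%N)) => [/mdeg1P[i /eqP->]|m1].
  rewrite (bigD1 i) //= mcoeffZ mcoeffX eqxx mulr1 big1 ?addr0 // => j ji.
  by rewrite mcoeffZ mcoeffX eq_mnm1 (negbTE ji) mulr0.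
rewrite memN_msupp_eq0; last by apply/negP => /hf /eqP; apply/negP.
rewrite big1 // => i _; rewrite mcoeffZ mcoeffX; case: eqP => [E|]; rewrite ?mulr0 //.
by move: m1; rewrite -E mdeg1.
Qed.

(* The substitution attached to the matrix P kills the forms of L and is the
   identity modulo L, so that R/L embeds in the domain R. *)
Lemma linear_forms_dichotomy (L : seq R) : (forall f, f \in L -> f \is 1.-homog) ->
  (n <= size L)%N /\ (forall i, gen L 'X_i) \/
  exists i, forall a, gen L (a * 'X_i) -> gen L a.
Proof.
move=> hL; pose m := size L; pose f (r : 'I_m) := nth 0 L r.
have fL r : f r \in L by apply: mem_nth.
pose M : 'M[k]_(m, n) := \matrix_(r, i) (f r)@_U_(i).
have fM r : f r = \sum_i M r i *: 'X_i.
  by rewrite {1}[f r]linear_form_sum ?hL //; apply: eq_bigr => i _; rewrite mxE.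
(* [M *m P = 0] makes the substitution kill the forms, while the rows of [pinvmx M *m M] are
   combinations of rows of [M], so each variable changes by an element of the ideal. *)
pose P := 1%:M - pinvmx M *m M.
have MP : M *m P = 0 by rewrite mulmxBr mulmx1 mulmxA mulmxKpV // subrr.
pose Y i : R := \sum_j P i j *: 'X_j.
pose phi : {rmorphism R -> R} := comp_mpoly [tuple Y i | i < n].
have phiX i : phi 'X_i = Y i by rewrite /phi /= comp_mpolyXU -tnth_nth tnth_mktuple.
have phiZ x a : phi (x *: a) = x *: phi a by rewrite /phi /= comp_mpolyZ.
clearbody phi.
have phi_f r : phi (f r) = 0.
  rewrite fM rmorph_sum /=.
  transitivity (\sum_j (M *m P) r j *: 'X_j : R); last first.
    by rewrite MP big1 // => j _; rewrite mxE scale0r.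
  under [RHS]eq_bigr => j _ do rewrite mxE scaler_suml.
  rewrite exchange_big; apply: eq_bigr => i _ /=.
  by rewrite phiZ phiX scaler_sumr; apply: eq_bigr => j _; rewrite scalerA.
have phi_gen a : gen L a -> phi a = 0.
  apply: (gen_min (I := fun a => phi a = 0)) => [|g /(nthP 0)[r rm <-]]; last exact: (phi_f (Ordinal rm)).
  split=> [|x y hx hy|x y hy]; first exact: rmorph0.
    by rewrite rmorphD hx hy addr0.
  by rewrite rmorphM hy mulr0.
have hG := gen_ideal L.
have phi_id a : gen L (a - phi a).
  have phiX_id i : gen L ('X_i - phi 'X_i).
    have -> : 'X_i - phi 'X_i = \sum_r (pinvmx M i r)%:MP * f r.
      rewrite phiX; under eq_bigr => r _ do rewrite fM mul_mpolyC scaler_sumr.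
      rewrite exchange_big /=.
      have {1}-> : 'X_i = \sum_j (1%:M : 'M[k]_n) i j *: 'X_j :> R.
        rewrite (bigD1 i) //= mxE eqxx scale1r big1 ?addr0 // => j ji.
        by rewrite mxE eq_sym (negbTE ji) scale0r.
      rewrite -sumrB; apply: eq_bigr => j _; rewrite -scalerBl.
      under eq_bigr => r _ do rewrite scalerA.
      by rewrite -scaler_suml; congr (_ *: _); rewrite !mxE subKr.
    by apply: ideal_sum => // r _; apply: idealMl => //; apply: gen_mem.
  have phiM_id x y : gen L (x - phi x) -> gen L (y - phi y) -> gen L (x * y - phi (x * y)).
    move=> hx hy; rewrite rmorphM.
    have -> : x * y - phi x * phi y = x * (y - phi y) + phi y * (x - phi x) by ring.
    by apply: idealD => //; apply: idealMl.
  have phi1_id : gen L (1 - phi 1) by rewrite rmorph1 subrr; apply: ideal0.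
  rewrite {1 2}[a]mpolyE rmorph_sum -sumrB; apply: ideal_sum => // j _.
  rewrite phiZ -scalerBr -mul_mpolyC; apply: idealMl => //.
  rewrite mpolyXE_id; elim/big_rec: _ => // i x _; apply: (phiM_id).
  by elim: (j i) => // e IH; rewrite exprS; apply: phiM_id.
(* Either all variables die, so that [M] has rank n, or some variable has a nonzero image in the
   domain and is regular modulo [L]. *)
case: (classic (forall i, phi 'X_i = 0)) => [phi0|/not_all_ex_not[i /eqP phi0]].
  left; split=> [|i]; last by move: (phi_id 'X_i); rewrite phi0 subr0.
  have P0 : P = 0.
    apply/matrixP => i j; have := congr1 (mcoeff U_(j)) (phi0 i).
    rewrite phiX raddf_sum /= (bigD1 j) //= big1 => [|l lj].
      by rewrite addr0 mcoeffZ mcoeffX eqxx mulr1 mcoeff0 => ->; rewrite mxE.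
    by rewrite mcoeffZ mcoeffX eq_mnm1 (negbTE lj) mulr0.
  have /(congr1 mxrank) : 1%:M = pinvmx M *m M by apply/eqP; rewrite -subr_eq0 -/P P0.
  rewrite mxrank1 => rk; apply: leq_trans (rank_leq_row M).
  by rewrite [X in (X <= _)%N]rk mxrankM_maxr.
right; exists i => a /phi_gen/eqP; rewrite rmorphM mulf_eq0 (negbTE phi0) orbF.
by move=> /eqP pa; move: (phi_id a); rewrite pa subr0.
Qed.

Definition forms s : seq R := unzip2 s.

(* Pairs (degree, form); the head of the list is the last form of the regular
   sequence. *)
Fixpoint regular_forms s : Prop :=
  if s is x :: s' then
    [/\ x.2 \is x.1.-homog, (0 < x.1)%N, regular_forms s' &
        forall a, gen (forms s') (a * x.2) -> gen (forms s') a]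
  else True.

Lemma regular_forms_tail x s : regular_forms (x :: s) -> regular_forms s.
Proof. by case. Qed.

Lemma regular_forms_homogeneous s : regular_forms s -> homogeneous_ideal (gen (forms s)).
Proof.
move=> hs; apply: gen_homogeneous => f /mapP[x xs ->]; exists x.1.
by elim: s xs hs => //= y s IH; rewrite inE => /orP[/eqP->|/IH h] [] // _ _ /h.
Qed.

Lemma regular_cons_has_no_socle x s :
  regular_forms (x :: s) -> has_no_socle (gen (forms s)).
Proof. by case=> h1 h2 _ h4; apply: regular_has_no_socle (gen_ideal _) h1 h2 h4. Qed.

Definition in_socle c a : Prop := ~ c a /\ forall i, c ('X_i * a).

(* If g a = f b modulo s, then a and b are simultaneously in the socles modulo
   (f, s) and (g, s). *)
Lemma socle_exchange (s : seq R) f d g e a r :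
  homogeneous_ideal (gen s) -> f \is d.-homog -> g \is e.-homog -> (0 < e)%N ->
  (forall x, gen s (x * f) -> gen s x) -> (forall x, gen s (x * g) -> gen s x) ->
  a \is r.-homog -> in_socle (gen (f :: s)) a ->
  exists b r', [/\ b \is r'.-homog, in_socle (gen (g :: s)) b & (r' + d = r + e)%N].
Proof.
move=> [hs hsh] hf hg e0 freg greg ha [na aX].
have [b0 hb0] : gen (f :: s) (g * a).
  exact: (homog_mem_irrelevant (colon_ideal a (gen_ideal (f :: s))) aX hg e0).
have := hsh _ (r + e)%N hb0.
rewrite raddfB /= (hpartM _ _ hf) (pihomog_dE (d := r + e)); last first.
  by rewrite mulrC; apply: dhomogM.
(* If the degree of [f] exceeds that of [g * a], the cofactor has no relevant component, so [g * a]
   lies in the smaller ideal and, by regularity of [g], so does [a]. *)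
case: leqP => dre hb; last first.
  by case: na; apply: gen_cons; apply: greg; rewrite mulrC -[_ * _]subr0.
set b := hpart _ _ in hb.
exists b, (r + e - d)%N; split; [exact: pihomogP| split | by rewrite subnK].
  case=> h hh; apply: na; exists h; apply: greg.
  have -> : (a - h * f) * g = (g * a - b * f) + (b - h * g) * f by ring.
  by apply: idealD => //; apply: idealMr.
move=> i; have [h hh] := aX i; exists h; apply: freg.
have -> : ('X_i * b - h * g) * f = g * ('X_i * a - h * f) - 'X_i * (g * a - b * f) by ring.
by apply: idealB => //; apply: idealMl.
Qed.

(** The point is to pass [l] below a form x of [F]: a x = b l modulo the rest gives b = e x, as [l]
    is regular modulo x and the rest, and cancelling x gives a = e l. *)
Lemma regular_forms_insert F L l : l \is 1.-homog -> regular_forms (F ++ L) ->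
  (forall i a, gen (forms (drop i F ++ L)) (a * l) -> gen (forms (drop i F ++ L)) a) ->
  regular_forms (F ++ (1%N, l) :: L).
Proof.
move=> hl; elim: F => [|x F IH] /=; first by move=> hL /(_ 0%N).
case=> h1 h2 h3 h4 hreg; split=> //.
  by apply: IH => // i; apply: (hreg i.+1).
have mem_ins : forms (F ++ (1%N, l) :: L) =i l :: forms (F ++ L).
  by move=> y; rewrite /forms /unzip2 !map_cat /= !(inE, mem_cat) orbCA.
move=> a /(gen_eqmem _ mem_ins)[b hb]; apply/(gen_eqmem _ mem_ins).
have [e he] : gen (x.2 :: forms (F ++ L)) b.
  apply: (hreg 0%N); exists a; rewrite -opprB; apply: idealN hb; exact: gen_ideal.
exists e; apply: h4.
have -> : (a - e * l) * x.2 = (a * x.2 - b * l) + (b - e * x.2) * l by ring.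
by apply: idealD (gen_ideal _) hb _; apply: idealMr (gen_ideal _) he.
Qed.

Hypothesis hk : [pchar k] =i pred0.

(** Each suffix is followed by one more regular form, the longest one by [x], so none of them has a
    socle. *)
Lemma eventually_regular_suffixes x F L : regular_forms (x :: F ++ L) ->
  exists B, forall t, (B <= t)%N -> forall i a,
    gen (forms (drop i F ++ L)) (a * moment_form k n t) -> gen (forms (drop i F ++ L)) a.
Proof.
elim: F x => [|y F IH] x hx.
  have [B hB] := eventually_regular_form hk
    (regular_forms_homogeneous (regular_forms_tail hx)) (regular_cons_has_no_socle hx).
  by exists B => t Bt i; apply: hB.
have hy : regular_forms (y :: F ++ L) := regular_forms_tail hx; have [B1 h1] := IH y hy.
have [B2 h2] := eventually_regular_form hk
    (regular_forms_homogeneous hy) (regular_cons_has_no_socle hx).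
exists (maxn B1 B2) => t; rewrite geq_max => /andP[t1 t2] [|i]; first exact: h2.
exact: h1.
Qed.

Definition socle_degree s : nat := \sum_(x <- s) x.1.-1.

(* The forms of F are exchanged one by one for linear forms, which reduces to a
   sequence of linear forms. *)
Lemma socle_of_regular_aux F L a e : regular_forms (F ++ L) ->
  (forall x, x \in L -> x.1 = 1%N) -> a \is e.-homog ->
  in_socle (gen (forms (F ++ L))) a ->
  (n <= size (F ++ L))%N /\ e = socle_degree (F ++ L).
Proof.
elim: F L a e => [|x F IH] L a e /= hreg hL ha soc_a.
  have [na aX] := soc_a.
  (* Only linear forms remain. If they generate all variables, a form outside their ideal has degree
     0; otherwise a regular variable excludes socle elements. *)
  have [|[nL LX]|[i regX]] := @linear_forms_dichotomy (forms L).
  - move=> f /mapP[y yL ->]; rewrite -(hL y yL).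
    elim: (L) hreg yL => //= z L' IH [? ? hL' _]; rewrite inE => /orP[/eqP->//|].
    exact: IH.
  - rewrite /socle_degree big_seq big1 => [|y /hL -> //].
    split; first by rewrite size_map in nL.
    case: e ha => // e ha; case: na.
    exact: homog_mem_irrelevant (gen_ideal _) LX ha _.
  - by case: na; apply: regX; rewrite mulrC.
have [hx x0 hFL xreg] := hreg.
have [B hB] := eventually_regular_suffixes hreg.
pose l := moment_form k n B; have hl : l \is 1.-homog by apply: moment_form_homog.
have {hB}lreg := hB B (leqnn B).
have lreg0 y : gen (forms (F ++ L)) (y * l) -> gen (forms (F ++ L)) y.
  by have := lreg 0%N y; rewrite drop0.
have [b [r [hb soc_b er]]] :=
  socle_exchange (regular_forms_homogeneous hFL) hx hl isT xreg lreg0 ha soc_a.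
have mem_ins : forms (F ++ (1%N, l) :: L) =i l :: forms (F ++ L).
  by move=> y; rewrite /forms /unzip2 !map_cat /= !(inE, mem_cat) orbCA.
have [||||n_le re] := IH ((1%N, l) :: L) b r.
- exact: regular_forms_insert.
- by move=> y; rewrite inE => /orP[/eqP->|/hL].
- by [].
- case: soc_b => nb bX; split=> [/(gen_eqmem _ mem_ins)//|i].
  exact/(gen_eqmem _ mem_ins).
split; first by move: n_le; rewrite !size_cat /= addnS.
(* By [er] the exchange lowers the degree of the socle element by [x.1 - 1], the contribution of
   [x]; the inserted linear form contributes 0. *)
move: re; rewrite /socle_degree big_cons !big_cat big_cons /=.
move: x0 er; lia.
Qed.

Lemma socle_of_regular s a e : regular_forms s -> a \is e.-homog ->
  in_socle (gen (forms s)) a -> (n <= size s)%N /\ e = socle_degree s.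
Proof.
move=> hs; rewrite -[s]cats0 in hs *; exact: socle_of_regular_aux.
Qed.

Lemma ex_regular_linear_form s : regular_forms s -> (size s < n)%N ->
  exists2 l, l \is 1.-homog & regular_forms ((1%N, l) :: s).
Proof.
move=> hs sn; have [|B hB] := eventually_regular_form hk (regular_forms_homogeneous hs).
  move=> a e ha aX; apply: NNPP => na.
  have [] : (n <= size s)%N /\ e = socle_degree s by apply: socle_of_regular ha _.
  by rewrite leqNgt sn.
exists (moment_form k n B); first exact: moment_form_homog.
split=> //; [exact: moment_form_homog|exact: hB].
Qed.

End RegularSequences.

(** * Hilbert functions *)

Section RelativeDimension.
Variables (k : fieldType) (V : lmodType k).
Implicit Types (U W X : V -> Prop).

Definition subspace U : Prop :=
  U 0 /\ forall (c : k) u v, U u -> U v -> U (c *: u + v).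

Definition free_mod U m (v : 'I_m -> V) : Prop :=
  forall c : 'I_m -> k, U (\sum_i c i *: v i) -> forall i, c i = 0.

Definition spans_mod U m (v : 'I_m -> V) W : Prop :=
  forall w, W w -> exists c : 'I_m -> k, U (w - \sum_i c i *: v i).

(** For subspaces this is the dimension of W modulo its intersection with U, expressed by
    representatives so that no quotient space is formed. *)
Definition reldim U W m : Prop :=
  exists v : 'I_m -> V, [/\ forall i, W (v i), spans_mod U v W & free_mod U v].

Lemma subspaceD U u v : subspace U -> U u -> U v -> U (u + v).
Proof. by case=> _ h Uu Uv; rewrite -[u]scale1r; apply: h. Qed.

Lemma subspaceZ U c u : subspace U -> U u -> U (c *: u).
Proof. by case=> U0 h Uu; rewrite -[_ *: _]addr0; apply: h. Qed.

Lemma subspaceB U u v : subspace U -> U u -> U v -> U (u - v).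
Proof.
by move=> hU Uu Uv; rewrite -scaleN1r; apply: subspaceD => //; apply: subspaceZ.
Qed.

Lemma subspace_sum U (T : Type) (r : seq T) (P : pred T) (F : T -> V) :
  subspace U -> (forall i, P i -> U (F i)) -> U (\sum_(i <- r | P i) F i).
Proof.
move=> hU UF; elim/big_ind: _ => //; first by case: hU.
by move=> x y; apply: subspaceD.
Qed.

Lemma subspace_subr U u v : subspace U -> U (u - v) -> U v -> U u.
Proof. by move=> hU Uuv Uv; rewrite -(subrK v u); apply: subspaceD. Qed.

(** If p < m, the m by p coefficient matrix has a nonzero left kernel vector, which is a relation
    among the [v i] modulo [U]. *)
Lemma free_le_spanning U W m p (v : 'I_m -> V) (w : 'I_p -> V) :
  subspace U -> (forall i, W (v i)) -> free_mod U v -> spans_mod U w W -> (m <= p)%N.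
Proof.
move=> hU Wv vfree wspan.
have [C hC] : exists C : 'I_m -> 'I_p -> k, forall i, U (v i - \sum_j C i j *: w j).
  apply: (functional_choice (Q := fun i c => U (v i - \sum_j c j *: w j))) => i.
  exact: wspan.
rewrite leqNgt; apply/negP => pm.
pose M : 'M[k]_(m, p) := \matrix_(i, j) C i j.
have : kermx M != 0.
  rewrite -mxrank_eq0 mxrank_ker -lt0n subn_gt0.
  exact: leq_ltn_trans (rank_leq_col M) pm.
case/rowV0Pn=> x /sub_kermxP xM /eqP x0; apply: x0; apply/matrixP => i0 i.
rewrite ord1 [RHS]mxE.
apply: vfree; apply: (@subspace_subr _ _ (\sum_j (x *m M) 0 j *: w j)) => //.
  suff -> : \sum_i x 0 i *: v i - \sum_j (x *m M) 0 j *: w j =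
      \sum_i x 0 i *: (v i - \sum_j C i j *: w j).
    by apply: subspace_sum => // l _; apply: subspaceZ.
  under [RHS]eq_bigr => l _ do rewrite scalerBr.
  rewrite sumrB; congr (_ - _).
  under [RHS]eq_bigr => l _ do rewrite scaler_sumr.
  rewrite exchange_big; apply: eq_bigr => j _ /=; rewrite mxE scaler_suml.
  by apply: eq_bigr => l _; rewrite mxE scalerA.
by rewrite xM big1 => [|j _]; [case: hU | rewrite mxE scale0r].
Qed.

Lemma reldim_unique U W m p : subspace U -> reldim U W m -> reldim U W p -> m = p.
Proof.
move=> hU [v [Wv vs vf]] [w [Ww ws wf]]; apply/eqP; rewrite eqn_leq.
by rewrite (free_le_spanning hU Wv vf ws) (free_le_spanning hU Ww wf vs).
Qed.

Lemma reldim_mono U U' W m p : subspace U -> subspace U' -> (forall x, U x -> U' x) ->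
  reldim U W m -> reldim U' W p -> (p <= m)%N.
Proof.
move=> hU hU' UU' [v [Wv vs vf]] [w [Ww ws wf]].
apply: (free_le_spanning hU Ww _ vs) => c /UU'; exact: wf.
Qed.

Lemma reldim_gt0 U W m x : reldim U W m -> W x -> ~ U x -> (0 < m)%N.
Proof.
case: m => // -[v [_ vs _]] Wx Ux; have [c] := vs x Wx.
by rewrite big_ord0 subr0 => /Ux.
Qed.

Lemma reldim_add U W X m p : subspace W -> (forall x, U x -> W x) ->
  (forall x, W x -> X x) -> reldim U W m -> reldim W X p -> reldim U X (m + p).
Proof.
move=> hW UW WX [v [Wv vs vf]] [w [Xw ws wf]].
pose vw (i : 'I_(m + p)) := match split i with inl j => v j | inr j => w j end.
have sumE (c : 'I_(m + p) -> k) : \sum_i c i *: vw i =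
    \sum_i c (lshift p i) *: v i + \sum_j c (rshift m j) *: w j.
  rewrite big_split_ord /=; congr (_ + _); apply: eq_bigr => i _; rewrite /vw.
    by rewrite (unsplitK (inl i)).
  by rewrite (unsplitK (inr i)).
exists vw; split.
- by move=> i; rewrite /vw; case: split => j; [apply: WX|].
- move=> x /ws[d /vs[c hcd]].
  exists (fun i => match split i with inl j => c j | inr j => d j end).
  rewrite sumE; under eq_bigr => i _ do rewrite (unsplitK (inl i)).
  under [X in _ - (_ + X)]eq_bigr => i _ do rewrite (unsplitK (inr i)).
  by rewrite opprD addrA addrAC.
- move=> c; rewrite sumE => Uc.
  have Wvc : W (\sum_i c (lshift p i) *: v i).
    by apply: subspace_sum => // i _; apply: subspaceZ.
  have d0 : forall j, c (rshift m j) = 0.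
    apply: wf; rewrite -[X in W X](addKr (\sum_i c (lshift p i) *: v i)) addrC.
    by apply: subspaceB => //; apply: UW.
  have c0 : forall j, c (lshift p j) = 0.
    apply: vf; move: Uc; rewrite [X in _ + X]big1 ?addr0 // => j _.
    by rewrite d0 scale0r.
  by move=> i; rewrite -(splitK i); case: split.
Qed.

Lemma free_mod_extend U m (v : 'I_m -> V) x : subspace U -> free_mod U v ->
  ~ (exists c : 'I_m -> k, U (x - \sum_i c i *: v i)) ->
  free_mod U (fun i : 'I_m.+1 => oapp v x (unlift ord_max i)).
Proof.
move=> hU vf nx c; rewrite big_ord_recr /= unlift_none /=.
have wl (i : 'I_m) : widen_ord (leqnSn m) i = lift ord_max i.
  by apply: val_inj; rewrite /= /bump leqNgt ltn_ord.
under eq_bigr => i _ do rewrite wl liftK /=.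
have [c0|c0] := eqVneq (c ord_max) 0 => Uc; last first.
  case: nx; exists (fun i => - (c (lift ord_max i) / c ord_max)).
  have := subspaceZ (c ord_max)^-1 hU Uc.
  rewrite scalerDr scalerA mulVf // scale1r scaler_sumr addrC.
  congr (U (_ + _)); rewrite -sumrN; apply: eq_bigr => i _.
  by rewrite scaleNr opprK scalerA mulrC.
move: Uc; rewrite c0 scale0r addr0 => /vf hv i.
by case: (unliftP ord_max i) => [j ->|->].
Qed.

(** Free families are extended until they span; [free_le_spanning] bounds their size by [p], so the
    fuel [r] suffices. *)
Lemma ex_reldim U W p (w : 'I_p -> V) : subspace U -> (forall i, W (w i)) ->
  spans_mod U w W -> exists m, reldim U W m.
Proof.
move=> hU Ww wspan.
suff ext r m (v : 'I_m -> V) : (p - m <= r)%N -> (forall i, W (v i)) -> free_mod U v ->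
    exists m, reldim U W m.
  by apply: (ext p 0%N (fun=> 0)) => [||c _ []//]; [lia | case].
elim: r m v => [|r IH] m v hr Wv vfree;
  (case: (classic (spans_mod U v W)) => [vs|]; first by exists m, v);
  move/not_all_ex_not => [x /(imply_to_and (W x))[Wx nx]];
  have vfree' := free_mod_extend hU vfree nx;
  have Wv' (i : 'I_m.+1) : W (oapp v x (unlift ord_max i)) by case: unlift => //=.
- have := free_le_spanning hU Wv' vfree' wspan; lia.
- by apply: IH vfree' => //; lia.
Qed.

End RelativeDimension.

Section RelativeDimensionMap.
Variables (k : fieldType) (V V' : lmodType k).

Lemma reldim_map (U W : V -> Prop) (U' W' : V' -> Prop) (f : V -> V') m :
  linear f -> subspace U' -> subspace W -> (forall w, W w -> W' (f w)) ->
  (forall w', W' w' -> exists2 w, W w & U' (w' - f w)) ->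
  (forall w, W w -> U' (f w) <-> U w) -> reldim U W m -> reldim U' W' m.
Proof.
move=> lf hU' hW WW' onto ker [v [Wv vs vf]].
have f0 : f 0 = 0 by have := lf (-1) 0 0; rewrite scaler0 addr0 scaleN1r addNr.
have fsum (c : 'I_m -> k) : f (\sum_i c i *: v i) = \sum_i c i *: f (v i).
  by elim/big_rec2: _ => // i x y _ <-; rewrite lf.
have Wsum (c : 'I_m -> k) : W (\sum_i c i *: v i).
  by apply: subspace_sum => // i _; apply: subspaceZ.
exists (f \o v); split.
- by move=> i; apply: WW'.
- move=> w' /onto[w Ww ww']; have [c hc] := vs w Ww; exists c.
  apply: (subspace_subr (v := f (w - \sum_i c i *: v i)) hU'); last first.
    by apply/ker => //; apply: subspaceB.
  have -> : f (w - \sum_i c i *: v i) = f w - \sum_i c i *: f (v i).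
    by rewrite addrC -scaleN1r lf fsum scaleN1r addrC.
  by rewrite opprB addrA subrK.
- move=> c hc; apply: vf; apply/ker; first exact: Wsum.
  by rewrite fsum.
Qed.

End RelativeDimensionMap.

(** * Hilbert functions of graded quotients *)

Section HilbertFunction.
Variables (k : fieldType) (n : nat).
Notation R := {mpoly k[n]}.
Implicit Types (c J : R -> Prop) (a b f g : R) (s : seq (nat * R)).

Notation hpart e a := (pihomog mdeg e a).

Definition forms_of_degree (j : nat) (a : R) : Prop := a \is j.-homog.
Definition graded_piece c (j : nat) (a : R) : Prop := c a /\ a \is j.-homog.

(** [epsilon] turns the relation into a function; [hilbert_funP] gives its value a meaning for
    ideals. *)
Definition hilbert_fun c (j : nat) : nat :=
  epsilon (inhabits 0%N) (reldim (graded_piece c j) (forms_of_degree j)).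

Lemma ideal_subspace c : is_ideal c -> subspace c.
Proof.
move=> hc; split=> [|x u v cu cv]; first exact: ideal0.
by apply: idealD => //; rewrite -mul_mpolyC; apply: idealMl.
Qed.

Lemma forms_of_degree_subspace j : subspace (forms_of_degree j).
Proof. by split=> [|x u v hu hv]; [apply: rpred0 | apply: rpredD => //; apply: rpredZ]. Qed.

Lemma graded_piece_subspace c j : is_ideal c -> subspace (graded_piece c j).
Proof.
move=> hc; have [c0 cD] := ideal_subspace hc.
have [h0 hD] := forms_of_degree_subspace j.
by split=> // x u v [cu hu] [cv hv]; split; [apply: cD | apply: hD].
Qed.

Lemma ex_monomials_of_degree j : exists2 s : seq 'X_{1..n},
  uniq s & forall m, (m \in s) = (mdeg m == j).
Proof.
exists (undup (map val [seq m : 'X_{1..n < j.+1} <- enum {: 'X_{1..n < j.+1}} | mdeg m == j])).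
  exact: undup_uniq.
move=> m; rewrite mem_undup; apply/mapP/eqP => [[x + ->]|mj].
  by rewrite mem_filter => /andP[/eqP].
have lt : (mdeg m < j.+1)%N by rewrite mj.
by exists (BMultinom lt) => //; rewrite mem_filter mem_enum /= mj eqxx.
Qed.

Lemma reldim_monomials (s : seq 'X_{1..n}) j : uniq s ->
  (forall m, (m \in s) = (mdeg m == j)) ->
  reldim (fun a : R => a = 0) (forms_of_degree j) (size s).
Proof.
move=> us hs; exists (fun i => 'X_[nth 0%MM s i]); split.
- by move=> i; rewrite /forms_of_degree dhomogX /= -hs mem_nth.
- move=> a ha; exists (fun i => a@_(nth 0%MM s i)); apply/eqP; rewrite subr_eq0; apply/eqP.
  rewrite -(big_mkord xpredT (fun i => a@_(nth 0%MM s i) *: 'X_[nth 0%MM s i])).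
  rewrite -(big_nth 0%MM xpredT (fun m => a@_m *: 'X_[m])).
  apply/mpolyP => m; rewrite raddf_sum /=.
  under eq_bigr => i _ do rewrite mcoeffZ mcoeffX.
  case: (boolP (m \in s)) => ms.
    rewrite (bigD1_seq m) //= eqxx mulr1 big1 ?addr0 // => i im.
    by rewrite (negbTE im) mulr0.
  rewrite big_seq big1 => [|i si].
    by apply: (dhomog_nemf_coeff ha); rewrite /= -hs.
  by case: eqP => [E|]; rewrite ?mulr0 //; move: ms; rewrite -E si.
- move=> x /= hx i; have := congr1 (mcoeff (nth 0%MM s i)) hx.
  rewrite raddf_sum /= (bigD1 i) //= mcoeffZ mcoeffX eqxx mulr1 mcoeff0.
  rewrite big1 ?addr0 // => l li; rewrite mcoeffZ mcoeffX nth_uniq //.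
  by case: eqP => [E|]; rewrite ?mulr0 //; case/eqP: li; apply: val_inj.
Qed.

Lemma ex_reldim_forms c j : is_ideal c ->
  exists m, reldim (graded_piece c j) (forms_of_degree j) m.
Proof.
move=> hc; have [s us hs] := ex_monomials_of_degree j.
have [v [hv vs _]] := reldim_monomials us hs.
apply: (ex_reldim (w := v)) => //; first exact: graded_piece_subspace.
move=> a /vs[x hx]; exists x; rewrite hx; split; first exact: ideal0.
exact: rpred0.
Qed.

Lemma hilbert_funP c j : is_ideal c ->
  reldim (graded_piece c j) (forms_of_degree j) (hilbert_fun c j).
Proof. by move=> /(ex_reldim_forms j); apply: epsilon_spec. Qed.

Lemma hilbert_fun_unique c j m : is_ideal c ->
  reldim (graded_piece c j) (forms_of_degree j) m -> hilbert_fun c j = m.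
Proof.
move=> hc; apply: (reldim_unique _ (hilbert_funP j hc)).
exact: graded_piece_subspace.
Qed.

Lemma hilbert_fun_mono c c' j : is_ideal c -> is_ideal c' -> ideal_sub c c' ->
  (hilbert_fun c' j <= hilbert_fun c j)%N.
Proof.
move=> hc hc' cc'.
apply: (reldim_mono (graded_piece_subspace j hc) (graded_piece_subspace j hc')) (hilbert_funP j hc) (hilbert_funP j hc').
by move=> x [/cc' ? ?]; split.
Qed.

Lemma hilbert_fun_gt0 c j g : is_ideal c -> g \is j.-homog -> ~ c g ->
  (0 < hilbert_fun c j)%N.
Proof.
by move=> hc hg cg; apply: (reldim_gt0 (hilbert_funP j hc) (x := g)) => // -[].
Qed.

(** Convertible with [gen (f :: s)] when [c] is [gen s], so that Hilbert functions follow the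
    recursion of [gen]. *)
Definition add_principal c f : R -> Prop := fun a => exists b, c (a - b * f).

Lemma add_principal_ideal c f : is_ideal c -> is_ideal (add_principal c f).
Proof.
move=> hc; split=> [|a b [a' ha] [b' hb]|a b [b' hb]].
- by exists 0; rewrite mul0r subr0; apply: ideal0.
- exists (a' + b'); have -> : a + b - (a' + b') * f = (a - a' * f) + (b - b' * f) by ring.
  exact: idealD.
- exists (a * b'); have -> : a * b - a * b' * f = a * (b - b' * f) by ring.
  exact: idealMl.
Qed.

(** Degree [j] of the exact sequence 0 -> R/(c : f)(-d) -> R/c -> R/(c + (f)) -> 0. *)
Lemma hilbert_fun_add_principal c f d j : homogeneous_ideal c -> f \is d.-homog ->
  hilbert_fun c j = (hilbert_fun (add_principal c f) j +
    (if d <= j then hilbert_fun (ideal_colon c f) (j - d) else 0))%N.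
Proof.
move=> [hc ch] hf; have hcf := add_principal_ideal f hc.
have sub_cf : ideal_sub c (add_principal c f).
  by move=> x cx; exists 0; rewrite mul0r subr0.
apply: hilbert_fun_unique => //; rewrite addnC.
apply: reldim_add (hilbert_funP j hcf).
- exact: graded_piece_subspace.
- by move=> x [/sub_cf ? ?]; split.
- by move=> x [].
(* As [c] is homogeneous, the cofactor can be replaced by its component of degree j - d, or by 0
   when j < d. *)
have hpart_cf a : a \is j.-homog -> add_principal c f a ->
    exists2 b, c (a - b * f) & (if (d <= j)%N then (b \is (j - d).-homog : Prop) else b = 0).
  move=> ha [b /(ch _ j)]; rewrite raddfB /= pihomog_dE // (hpartM _ _ hf).
  case: ifP => dj hb; first by exists (hpart (j - d) b); last exact: pihomogP.
  by exists 0; rewrite ?mul0r.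
case: ifPn => dj.
- apply: (reldim_map (f := fun a => a * f)) (hilbert_funP (j - d) (colon_ideal f hc)) => //=.
  + by move=> x u v; rewrite /= mulrDl scalerAl.
  + exact: graded_piece_subspace.
  + exact: forms_of_degree_subspace.
  + move=> w hw; split; last by rewrite -(subnK dj); apply: dhomogM.
    by exists w; rewrite subrr; apply: ideal0.
  + move=> a [acf ha]; have [b hb] := hpart_cf a ha acf; rewrite dj => bh.
    exists b => //; split=> //; apply: rpredB => //.
    by rewrite -(subnK dj); apply: dhomogM.
  + move=> w hw; split=> [[]|[]] // cw _; split=> //.
    by rewrite -(subnK dj); apply: dhomogM.
- exists (fun=> 0); split=> [[]//||? _ []//] a [acf ha].
  exists (fun=> 0); rewrite big_ord0 subr0; have [b] := hpart_cf a ha acf.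
  by rewrite (negbTE dj) => + b0; rewrite b0 mul0r subr0.
Qed.

End HilbertFunction.

(** * Coefficients of z^e / (1 - z)^m *)

Section SimplicialNumbers.
Implicit Types (h : nat -> nat) (e j m : nat).

(* Hilbert function of a polynomial ring in m variables. *)
Definition simplicial m j : nat := if m is m'.+1 then 'C(j + m', m') else (j == 0%N).

(** On generating series, multiplication by z^e. *)
Definition shift e h j : nat := if (e <= j)%N then h (j - e)%N else 0%N.

(** Pascal's rule: on generating series, 1/(1 - z)^(m+1) is multiplied by 1 - z. *)
Lemma simplicialS m j :
  simplicial m.+1 j = (simplicial m j + shift 1 (simplicial m.+1) j)%N.
Proof.
case: j => [|j]; first by case: m => [|m]; rewrite /shift //= !add0n !binn.
rewrite /shift /= subn1; case: m => [|m] /=; first by rewrite !bin0.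
by rewrite addSn binS addnC addSnnS.
Qed.

Lemma sum_simplicial m j : (\sum_(i < j.+1) simplicial m i)%N = simplicial m.+1 j.
Proof.
elim: j => [|j IH].
  by rewrite big_ord1 simplicialS /shift addn0.
by rewrite big_ord_recr /= IH [RHS]simplicialS addnC /shift /= subn1.
Qed.

Lemma sum_shift e h j :
  (\sum_(i < j.+1) shift e h i)%N = shift e (fun i => \sum_(l < i.+1) h l)%N j.
Proof.
elim: j => [|j IH].
  by rewrite big_ord1 /shift; case: e => //=; rewrite big_ord1.
rewrite big_ord_recr /= IH /shift; case: (leqP e j) => ej.
  by rewrite (leqW ej) subSn // [in RHS]big_ord_recr.
rewrite add0n; case: (leqP e j.+1) => // ej1.
have -> : e = j.+1 by lia.
by rewrite subnn big_ord1.
Qed.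

Lemma sum_shift_simplicial e m j :
  (\sum_(i < j.+1) shift e (simplicial m) i)%N = shift e (simplicial m.+1) j.
Proof. by rewrite sum_shift /shift sum_simplicial. Qed.

(** This is 1/(1 - z)^(m+1) = (1 + ... + z^(d-1))/(1 - z)^m + z^d/(1 - z)^(m+1), multiplied by
    z^e. *)
Lemma shift_simplicialS d e m j : shift e (simplicial m.+1) j =
  (\sum_(i < d) shift (e + i) (simplicial m) j + shift (e + d) (simplicial m.+1) j)%N.
Proof.
elim: d => [|d ->]; first by rewrite big_ord0 addn0.
rewrite big_ord_recr /= -addnA; congr (_ + _)%N.
rewrite /shift addnS; case: (leqP (e + d) j) => ed; last by rewrite leqNgt ltnS ltnW.
by rewrite simplicialS /shift subn_gt0 subn1 -subnS.
Qed.

Lemma simplicial_mono m i j : (i <= j)%N -> (simplicial m.+1 i <= simplicial m.+1 j)%N.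
Proof. by move=> ij; rewrite /=; apply: leq_bin2l; rewrite leq_add2r. Qed.

End SimplicialNumbers.

(** * Hilbert functions modulo a regular sequence and its colon ideals *)

Section RegularHilbert.
Variables (k : fieldType) (n : nat).
Hypothesis hk : [pchar k] =i pred0.
Notation R := {mpoly k[n]}.
Implicit Types (c J : R -> Prop) (a b f g : R) (s : seq (nat * R)).

Notation hpart e a := (pihomog mdeg e a).

Lemma hilbert_fun_regular s d f j : regular_forms ((d, f) :: s) ->
  hilbert_fun (gen (forms s)) j =
    (hilbert_fun (gen (forms ((d, f) :: s))) j + shift d (hilbert_fun (gen (forms s))) j)%N.
Proof.
case=> /= hf _ hs freg; have hom := regular_forms_homogeneous hs.
rewrite (hilbert_fun_add_principal j hom hf) /shift; congr (_ + _)%N.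
case: ifP => // _; apply/eqP; rewrite eqn_leq; have [hc _] := hom.
have hcf := colon_ideal f hc.
apply/andP; split; apply: hilbert_fun_mono => // x cx.
exact: idealMr.
Qed.

Lemma hilbert_fun_nil j : hilbert_fun (gen (forms ([::] : seq (nat * R)))) j = simplicial n j.
Proof.
apply: hilbert_fun_unique; first exact: gen_ideal.
have [s us hs] := ex_monomials_of_degree n j.
have -> : simplicial n j = size s.
  case: (n) s us hs => [|m] s us hs.
    have all0 (m : 'X_{1..0}) : m = 0%MM by apply/mnmP; case.
    case: s us hs => [|x s] /= us hs.
      by have := hs 0%MM; rewrite mdeg0 in_nil eq_sym => <-.
    have := hs x; rewrite mem_head (all0 x) mdeg0 eq_sym => <-.
    by case: s us {hs} => // y s; rewrite (all0 x) (all0 y) mem_head.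
  rewrite /= -bin_sub ?leq_addl // addnK -(size_basis m j); apply: perm_size.
  apply: uniq_perm => // [|y]; first exact: uniq_basis.
  by rewrite hs basis_cover.
have [v [hv vs vf]] := reldim_monomials k us hs.
exists v; split=> // [w /vs[x hx]|x [hx _]]; last exact: vf.
by exists x; rewrite hx; split; [|apply: rpred0].
Qed.

Lemma gen_not1_tail s x : ~ gen (forms (x :: s)) 1 -> ~ gen (forms s) 1.
Proof. by move=> h g1; apply: h; apply: gen_cons. Qed.

(** [E] lists, with multiplicity, the exponents in the product of the 1 + z + ... + z^(d_i - 1), the
    numerator of the Hilbert series over (1 - z)^(n - size s). *)
Lemma hilbert_fun_shifts s : regular_forms s -> (size s <= n)%N ->
  exists2 E : seq nat, size E = (\prod_(x <- s) x.1)%N &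
    forall j, hilbert_fun (gen (forms s)) j =
      (\sum_(e <- E) shift e (simplicial (n - size s)) j)%N.
Proof.
elim: s => [|[d f] s IH] hs sn.
  exists [:: 0%N] => [|j]; first by rewrite big_nil.
  by rewrite big_seq1 subn0 /shift /= subn0 hilbert_fun_nil.
have [E sE hE] := IH (regular_forms_tail hs) (ltnW sn).
exists [seq (e + i)%N | e <- E, i <- iota 0 d] => [|j].
  by rewrite size_allpairs size_iota sE big_cons mulnC.
have := hilbert_fun_regular j hs; rewrite hE.
have -> : shift d (hilbert_fun (gen (forms s))) j =
    (\sum_(e <- E) shift (e + d) (simplicial (n - size s)) j)%N.
  rewrite /shift; case: (leqP d j) => dj.
    rewrite hE; apply: eq_bigr => e _; rewrite /shift leq_subRL // addnC.
    by rewrite subnDA subnAC.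
  by rewrite big1 // => e _; rewrite ifF //; lia.
have nS : (n - size s = (n - size ((d, f) :: s)).+1)%N by rewrite /= subnSK.
rewrite nS; under eq_bigr => e _ do rewrite (shift_simplicialS d).
rewrite big_split => /addIn <-; rewrite big_flatten big_map.
apply: eq_bigr => e _; rewrite big_map.
rewrite -(big_mkord xpredT (fun i => shift (e + i) (simplicial (n - size ((d, f) :: s))) j)).
by rewrite /index_iota subn0.
Qed.

(** After n forms the Hilbert function vanishes in large degrees, whereas the powers of a further
    regular form stay nonzero. *)
Lemma regular_forms_size_le s : regular_forms s -> ~ gen (forms s) 1 -> (size s <= n)%N.
Proof.
elim: s => // -[d f] s IH hs n1; have hs' := regular_forms_tail hs.
have n1' := gen_not1_tail n1.
suff : (size s < n)%N by []; rewrite ltn_neqAle IH // andbT; apply/eqP => sn.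
have [E _ hE] := hilbert_fun_shifts hs' (eq_leq sn).
have [hf d0 _ freg] := hs; rewrite /= in hf d0 freg.
pose M := (\max_(e <- E) e).+1.
have : (0 < hilbert_fun (gen (forms s)) (d * M))%N.
  apply: (hilbert_fun_gt0 (g := f ^+ M)); [exact: gen_ideal|exact: dhomogMn|].
  by elim: M => [|m IHm]; [rewrite expr0|rewrite exprSr => /freg].
rewrite hE sn subnn big_seq big1 // => e eE; rewrite /shift.
have : (e < M)%N by rewrite ltnS; apply: leq_bigmax_seq.
by case: ifP => //= h; case: eqP => //; nia.
Qed.

(** Multiply by one variable at a time; a multiple killed by all variables would be a socle element,
    whose degree is already [socle_degree s]. *)
Lemma nonzero_multiple s f d j : regular_forms s -> f \is d.-homog ->
  ~ gen (forms s) f -> (j <= socle_degree s - d)%N ->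
  exists2 g, g \is j.-homog & ~ gen (forms s) (g * f).
Proof.
move=> hs hf nf; elim: j => [|j IH] hj.
  by exists 1; [exact: dhomog1|rewrite mul1r].
have [g hg ng] := IH (ltnW hj).
suff [i ni] : exists i, ~ gen (forms s) ('X_i * (g * f)).
  by exists ('X_i * g); [exact: (dhomogM (homogX _ i) hg)|rewrite -mulrA].
apply: not_all_ex_not => gX.
have [] : (n <= size s)%N /\ (j + d)%N = socle_degree s.
  by apply: socle_of_regular (dhomogM hg hf) _.
by move=> _ E; move: hj; rewrite -E; lia.
Qed.

(* For a linear form l regular modulo s, write f = l^a f'' modulo s with f'' not
   in (l, s): the annihilators of f and f'' modulo s agree, and modulo l this
   annihilator is contained in that of f'' modulo (l, s). *)
Lemma hilbert_fun_colon_ge s f d j : regular_forms s -> f \is d.-homog ->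
  ~ gen (forms s) f ->
  (\sum_(i < (socle_degree s - d).+1) shift i (simplicial (n - size s)) j <=
     hilbert_fun (ideal_colon (gen (forms s)) f) j)%N.
Proof.
move En : (n - size s)%N => D; elim: D s f d j En => [|D IH] s f d j En hs hf nf.
  (* [simplicial 0] is concentrated in degree 0, so the sum is 1 for j up to [socle_degree s - d]
     and 0 beyond. *)
  have [hj|hj] := leqP j (socle_degree s - d); last first.
    by rewrite big1 // => i _; rewrite /shift; case: ifP => //= h; case: eqP => // ?; have := ltn_ord i; lia.
  have [g hg ng] := nonzero_multiple hs hf nf hj.
  apply: (@leq_trans 1); last first.
    by apply: hilbert_fun_gt0 hg _ => //; apply/colon_ideal/gen_ideal.
  rewrite (bigD1 (Ordinal (hj : (j < _.+1)%N))) //= /shift leqnn subnn /= big1 //.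
  move=> i ij; case: ifP => //= h; case: eqP => // ?.
  by case/eqP: ij; apply: val_inj => /=; lia.
have sn : (size s < n)%N by rewrite -subn_gt0 En.
have [l hl hls] := ex_regular_linear_form hk hs sn.
have [hc ch] := regular_forms_homogeneous hs.
have [_ _ _ lreg] := hls; rewrite /= in lreg.
have main (r : nat) g : g \is r.-homog -> ~ gen (forms ((1%N, l) :: s)) g ->
    (\sum_(i < (socle_degree s - r).+1) shift i (simplicial D.+1) j <=
       hilbert_fun (ideal_colon (gen (forms s)) g) j)%N.
  move=> hg ng; set J := ideal_colon _ g.
  have hJ : homogeneous_ideal J := colon_homogeneous (regular_forms_homogeneous hs) hg.
  have hJl := add_principal_ideal l hJ.1.
  (* [l] is regular modulo [J] because it is so modulo [s]; hence the function of [J] is the partial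
     sum of that of [J + (l)]. *)
  have JE i : hilbert_fun J i =
      (hilbert_fun (add_principal J l) i + shift 1 (hilbert_fun J) i)%N.
    rewrite (hilbert_fun_add_principal i hJ hl) /shift; congr (_ + _)%N.
    case: ifP => // _; apply/eqP; rewrite eqn_leq.
    have hJ' := colon_ideal l hJ.1.
    apply/andP; split; apply: hilbert_fun_mono => //; try exact: hJ.1.
      by move=> x Jx; apply: idealMr Jx; exact: hJ.1.
    by move=> x; rewrite /J /ideal_colon mulrAC => /lreg.
  have -> : hilbert_fun J j = (\sum_(i < j.+1) hilbert_fun (add_principal J l) i)%N.
    elim: (j) => [|i IHi]; first by rewrite JE big_ord1 /shift addn0.
    by rewrite big_ord_recr /= -IHi JE addnC /shift subn1.
  under eq_bigr => i _ do rewrite -sum_shift_simplicial.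
  rewrite exchange_big /=; apply: leq_sum => i _.
  have nD : (n - size ((1%N, l) :: s) = D)%N by rewrite /= subnS En.
  apply: leq_trans (_ : _ <= hilbert_fun (ideal_colon (gen (forms ((1%N, l) :: s))) g) i)%N _.
    by have := IH _ g r i nD hls hg ng; rewrite /socle_degree big_cons.
  apply: hilbert_fun_mono => //; first exact/colon_ideal/gen_ideal.
  move=> x [b hb]; exists (b * g); move: hb.
  by rewrite /J /ideal_colon mulrBl mulrAC.
(* Each division by [l] lowers the degree, so this stops: a form of degree 0 in (l, s) already lies
   in the ideal of s. *)
elim: d f hf nf => [|d IHd] f hf nf;
    (case: (classic (gen (forms ((1%N, l) :: s)) f)) => [[b0 hb0]|]; last exact: main).
  case: nf; have := ch _ 0%N hb0.
  by rewrite raddfB /= pihomog_dE // (hpartM _ _ hl) subr0.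
set b := hpart d b0; have hb : gen (forms s) (f - b * l).
  by have := ch _ d.+1 hb0; rewrite raddfB /= pihomog_dE // (hpartM _ _ hl) subn1.
have nb : ~ gen (forms s) b.
  by move=> cb; apply: nf; apply: (ideal_subr hc hb); apply: idealMr.
apply: leq_trans (_ : _ <= hilbert_fun (ideal_colon (gen (forms s)) b) j)%N _.
  (* A smaller degree only adds summands to the lower bound. *)
  apply: leq_trans (IHd b (pihomogP _ _ _) nb).
  rewrite -!(big_mkord xpredT (fun i => shift i (simplicial D.+1) j)).
  by rewrite [X in (_ <= X)%N](big_cat_nat (n := (socle_degree s - d.+1).+1)) ?leq_addr //; lia.
apply: hilbert_fun_mono; try exact: colon_ideal.
move=> x; rewrite /ideal_colon => cxf; apply: lreg.
have -> : x * b * l = x * f - x * (f - b * l) by ring.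
by apply: idealB => //; apply: idealMl.
Qed.

End RegularHilbert.

(** * Lengths of truncated quotients *)

Section Length.
Variables (k : fieldType) (n : nat).
Notation R := {mpoly k[n]}.
Implicit Types (I J U W : R -> Prop) (a b f g : R).

Notation hpart e a := (pihomog mdeg e a).
Notation M := (@irrelevant_ideal k n).

Lemma ideal_exp_ideal t : is_ideal (ideal_exp M t).
Proof.
case: t => [|t]; first by split.
split=> [|a b [r1 [b1 [c1 [h1 ->]]]] [r2 [b2 [c2 [h2 ->]]]]|a b [r [b1 [c1 [h1 ->]]]]].
- by exists 0%N, (fun=> 0), (fun=> 0); split=> [[]//|]; rewrite big_ord0.
- exists (r1 + r2)%N, (fun i => match split i with inl j => b1 j | inr j => b2 j end),
    (fun i => match split i with inl j => c1 j | inr j => c2 j end).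
  split=> [i|]; first by case: split.
  rewrite big_split_ord /=; congr (_ + _); apply: eq_bigr => i _.
    by rewrite (unsplitK (inl i)).
  by rewrite (unsplitK (inr i)).
- exists r, (fun i => a * b1 i), c1; split=> [i|]; last first.
    by rewrite mulr_sumr; apply: eq_bigr => i _; rewrite mulrA.
  case: (h1 i) => -[x ->] ?; split=> //; exists (fun j => a * x j).
  by rewrite mulr_sumr; apply: eq_bigr => j _; rewrite mulrA.
Qed.

Lemma irrelevantX i : M ('X_i : R).
Proof.
exists (fun j => (j == i)%:R); rewrite (bigD1 i) //= eqxx mul1r big1 ?addr0 // => j ji.
by rewrite (negbTE ji) mul0r.
Qed.

Lemma ideal_expX t i a : ideal_exp M t a -> ideal_exp M t.+1 ('X_i * a).
Proof.
move=> ha; exists 1%N, (fun=> 'X_i), (fun=> a); rewrite big_ord1; split=> // _.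
by split=> //; exact: irrelevantX.
Qed.

Lemma homog_ideal_exp t e f : f \is e.-homog -> (t <= e)%N -> ideal_exp M t f.
Proof.
move=> /dhomogP hf te; rewrite [f]mpolyE big_seq.
apply: ideal_sum => [|m /hf /= me]; first exact: ideal_exp_ideal.
rewrite -mul_mpolyC; apply: idealMl; first exact: ideal_exp_ideal.
rewrite -me {me hf} in te; elim: t m te => [|t IH] m tm //.
have /existsP[i mi] : [exists i, m i != 0%N].
  rewrite -negb_forall; apply/negP => /forallP m0; move: tm.
  by rewrite mdegE big1 // => i _; apply/eqP.
have Um : (U_(i) <= m)%MM.
  by apply/mnm_lepP => j; rewrite mnm1E; case: eqP => // <-; rewrite lt0n.
rewrite -(submK Um) addmC mpolyXD; apply: ideal_expX; apply: IH.
by move: tm; rewrite -{1}(submK Um) mdegD mdeg1 addn1.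
Qed.

Lemma hpart_ideal_exp t e a : ideal_exp M t a -> (e < t)%N -> hpart e a = 0.
Proof.
elim: t e a => // t IH e a [r [b [c [h ->]]]] et; rewrite raddf_sum big1 // => i _ /=.
have [[x ->] hc] := h i; rewrite mulr_suml raddf_sum big1 // => j _ /=.
rewrite mulrAC (hpartM _ _ (homogX k j)); case: ifP => // e0.
rewrite [c i](hpart_sum) mulr_sumr raddf_sum /= big1 ?mul0r // => l _.
rewrite (hpartM _ _ (pihomogP _ _ _)); case: ifP => // le.
by rewrite (IH l (c i) hc) ?mulr0 //; lia.
Qed.

(* J + m^t for homogeneous J. *)
Definition truncation J t : R -> Prop := fun a => forall e, (e < t)%N -> J (hpart e a).

Lemma truncationE J t a : homogeneous_ideal J ->
  ideal_add J (ideal_exp M t) a <-> truncation J t a.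
Proof.
case=> hJ Jh; split=> [[b [c [Jb hc ->]]] e et|ha].
  by rewrite raddfD /= (hpart_ideal_exp hc et) addr0; apply: Jh.
exists (\sum_(e < msize a | (e < t)%N) hpart e a),
  (\sum_(e < msize a | ~~ (e < t)%N) hpart e a); split.
- by apply: ideal_sum => // i /ha.
- apply: ideal_sum => [|i it]; first exact: ideal_exp_ideal.
  by apply: (homog_ideal_exp (pihomogP _ _ _)); rewrite leqNgt.
- by rewrite {1}[a]hpart_sum (bigID (fun e : 'I__ => (e < t)%N)).
Qed.

Lemma truncation_ideal J t : homogeneous_ideal J -> is_ideal (truncation J t).
Proof.
case=> hJ Jh; split=> [e _|a b ha hb e et|a b hb e et].
- by rewrite raddf0; apply: ideal0.
- by rewrite raddfD /=; apply: idealD; [|apply: ha|apply: hb].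
- rewrite [a]hpart_sum mulr_suml raddf_sum /=; apply: ideal_sum => // i _.
  rewrite mulrC (hpartM _ _ (pihomogP _ _ _)); case: ifP => ie; last exact: ideal0.
  by apply: idealMr => //; apply: hb; lia.
Qed.

Lemma truncationS J t a : truncation J t.+1 a -> truncation J t a.
Proof. by move=> ha e et; apply: ha; apply: ltnW. Qed.

Lemma truncationX J t i a : homogeneous_ideal J ->
  truncation J t a -> truncation J t.+1 ('X_i * a).
Proof.
case=> hJ _ ha e et; rewrite mulrC (hpartM _ _ (homogX k i)).
by case: ifP => e0; [apply: idealMr => //; apply: ha; lia|apply: ideal0].
Qed.

Lemma reldim_truncation J t : homogeneous_ideal J ->
  reldim (truncation J t.+1) (truncation J t) (hilbert_fun J t).
Proof.
move=> hom; have [hJ Jh] := hom.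
apply: (reldim_map (f := id)) (hilbert_funP t hJ) => //.
- exact/ideal_subspace/truncation_ideal.
- exact: forms_of_degree_subspace.
- move=> w hw e et; rewrite (hpart_homog _ hw) ltn_eqF //; exact: ideal0.
- move=> w hw; exists (hpart t w); first exact: pihomogP.
  move=> e et; rewrite raddfB /= (hpart_homog _ (pihomogP _ _ _)).
  case: eqP => [->|ne]; first by rewrite subrr; apply: ideal0.
  by rewrite subr0; apply: hw; lia.
- move=> w hw; split=> [/(_ t (ltnSn t))|[Jw _] e _]; last exact: Jh.
  by rewrite pihomog_dE.
Qed.

Lemma reldim_truncation_sum J t : homogeneous_ideal J ->
  reldim (truncation J t) (@unit_ideal R) (\sum_(i < t) hilbert_fun J i)%N.
Proof.
move=> hom; elim: t => [|t IH].
  rewrite big_ord0; exists (fun=> 0); split=> [[]//|a _|c _ []//].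
  by exists (fun=> 0).
rewrite big_ord_recr /= addnC; apply: reldim_add (reldim_truncation t hom) IH => //.
  exact/ideal_subspace/truncation_ideal.
exact: truncationS.
Qed.

(** An element new at each step of the chain gives a family free modulo [J]. *)
Lemma chain_length_le J l m : is_ideal J -> reldim J (@unit_ideal R) m ->
  ideal_chain_above J l -> (l <= m)%N.
Proof.
move=> hJ [w [_ ws _]] [C [hC Cs]].
have [v hv] : exists v : 'I_l -> R, forall i : 'I_l, C i.+1 (v i) /\ ~ C i (v i).
  apply: (functional_choice (Q := fun (i : 'I_l) x => C i.+1 x /\ ~ C i x)) => i.
  have [_ ns] := Cs i (ltn_ord i); apply: NNPP => no; apply: ns => x hx.
  by apply: NNPP => nx; apply: no; exists x.
have mono i j : (i <= j)%N -> (j <= l)%N -> ideal_sub (C i) (C j).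
  move=> /subnK <-; elim: (j - i)%N => [_ x|r IH rl x hx]; first by rewrite add0n.
  by have [h _] := Cs (r + i)%N rl; apply: h; apply: IH => //; apply: ltnW.
apply: (free_le_spanning (W := @unit_ideal R) (ideal_subspace hJ) _ (v := v) _ ws) => //.
move=> c Jc.
(* Coefficients vanish from the top index downwards: [v i] lies outside [C i], which contains [J]
   and all earlier [v j]. *)
suff H r : (r <= l)%N -> forall i : 'I_l, (l - r <= i)%N -> c i = 0.
  by move=> i; apply: (H l) => //; rewrite subnn.
elim: r => [|r IH] rl i hi; first by have := ltn_ord i; lia.
have [hi'|hi'] := ltnP i (l - r); last by apply: IH => //; apply: ltnW.
apply: NNPP => /eqP ci; have [_] := hv i; apply.
have [hCi JCi] := hC i (ltnW (ltn_ord i)).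
suff h : C i (c i *: v i).
  by rewrite -[v i]scale1r -(mulVf ci) -scalerA; apply: subspaceZ h; apply: ideal_subspace.
apply: (subspace_subr (v := - \sum_(j | j != i) c j *: v j) (ideal_subspace hCi)).
  by rewrite opprK; have := JCi _ Jc; rewrite (bigD1 i).
apply: idealN => //; apply: ideal_sum => // j ji.
have [ij|ij] := ltnP j i; last first.
  rewrite IH ?scale0r; [exact: ideal0|exact: ltnW|].
  by move: ji; rewrite -val_eqE /=; lia.
apply: subspaceZ; first exact: ideal_subspace.
by apply: (mono j.+1) => //; [exact: ltnW|case: (hv j)].
Qed.

Lemma homog0_const f : f \is 0.-homog -> f = (f@_0)%:MP.
Proof.
move=> hf; apply/mpolyP => m; rewrite mcoeffC.
have [->|m0] := eqVneq m 0%MM; first by rewrite mulr1.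
rewrite mulr0; apply: (dhomog_nemf_coeff hf).
by rewrite /= mdeg_eq0.
Qed.

(* When the variables map W into U, every subspace between U and W is an ideal. *)
Lemma ideal_chain_extend U W m l : is_ideal U -> is_ideal W -> ideal_sub U W ->
  (forall i a, W a -> U ('X_i * a)) -> reldim U W m ->
  ideal_chain_above W l -> ideal_chain_above U (m + l).
Proof.
move=> hU hW UW WX [v [Wv vs vf]] [C [hC Cs]].
have sU := ideal_subspace hU.
(* [U] plus the span of the first [i] vectors; padding with 0 keeps the index type fixed. *)
pose S (i : nat) (x : R) := exists c : 'I_m -> k,
  U (x - \sum_(j < m) (if (j < i)%N then c j else 0) *: v j).
have SU i : ideal_sub U (S i).
  move=> x Ux; exists (fun=> 0); rewrite big1 ?subr0 // => j _.
  by rewrite if_same scale0r.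
have SW i : ideal_sub (S i) W.
  move=> x [c /UW hc]; apply: (ideal_subr hW hc).
  by apply: ideal_sum => // j _; rewrite -mul_mpolyC; apply: idealMl.
(* On [W] modulo [U] a polynomial acts through its constant term. *)
have scal r w : W w -> U (r * w - (hpart 0%N r)@_0 *: w).
  move=> Ww; rewrite -mul_mpolyC -mulrBl.
  suff h : ideal_colon U w (r - ((hpart 0%N r)@_0)%:MP) by [].
  have hUw := colon_ideal w hU.
  rewrite -(homog0_const (pihomogP _ _ _)); case E : (msize r) => [|p].
    have -> : r = 0 by apply/eqP; rewrite -msize_poly_eq0 E.
    by rewrite raddf0 subrr; apply: ideal0.
  rewrite {1}[r]hpart_sum E big_ord_recl /= addrC addKr.
  apply: ideal_sum => // i _.
  apply: (homog_mem_irrelevant hUw _ (pihomogP _ _ _)) => // j.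
  exact: WX.
have SI i : is_ideal (S i).
  split=> [|x y [cx hx] [cy hy]|r x [c hc]].
  - by apply: SU; apply: ideal0.
  - exists (fun j => cx j + cy j).
    suff -> : \sum_(j < m) (if (j < i)%N then cx j + cy j else 0) *: v j =
      \sum_(j < m) (if (j < i)%N then cx j else 0) *: v j +
      \sum_(j < m) (if (j < i)%N then cy j else 0) *: v j.
      by rewrite opprD addrACA; apply: idealD.
    rewrite -big_split; apply: eq_bigr => j _ /=; rewrite -scalerDl.
    by case: ifP => //; rewrite addr0.
  - exists (fun j => (hpart 0%N r)@_0 * c j).
    suff -> : \sum_(j < m) (if (j < i)%N then (hpart 0%N r)@_0 * c j else 0) *: v j =
      (hpart 0%N r)@_0 *: \sum_(j < m) (if (j < i)%N then c j else 0) *: v j.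
      set s := \sum_j _ in hc *.
      have -> : r * x - (hpart 0%N r)@_0 *: s = r * (x - s) + (r * s - (hpart 0%N r)@_0 *: s) by ring.
      apply: idealD => //; first exact: idealMl.
      apply: scal; apply: ideal_sum => // j _.
      by rewrite -mul_mpolyC; apply: idealMl.
    rewrite scaler_sumr; apply: eq_bigr => j _; rewrite scalerA.
    by case: ifP => //; rewrite mulr0.
have Sv (i : 'I_m) (r : nat) : (i < r)%N -> S r (v i).
  move=> ir; exists (fun j => (j == i)%:R); rewrite (bigD1 i) //= ir eqxx scale1r.
  rewrite big1 ?addr0 ?subrr => [|x xi]; first exact: ideal0.
  by rewrite (negbTE xi) if_same scale0r.
have nSv (i : 'I_m) : ~ S i (v i).
  case=> c hc; have : U (\sum_(j < m) ((j == i)%:R - (if (j < i)%N then c j else 0)) *: v j).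
    under eq_bigr => j _ do rewrite scalerBl.
    rewrite sumrB (bigD1 i) //= eqxx scale1r big1 ?addr0 // => j ji.
    by rewrite (negbTE ji) scale0r.
  by move=> /vf/(_ i)/eqP; rewrite eqxx ltnn subr0 oner_eq0.
(* The ideals [S 0], ..., [S (m - 1)] precede the chain above [W]; at the junction the last vector
   of [v] is new. *)
exists (fun i => if (i < m)%N then S i else C (i - m)%N); split=> i hi.
  case: ltnP => im; first by split.
  have [|hCi WC] := hC (i - m)%N; first by lia.
  by split=> // x /UW /WC.
case: (ltnP i m) => im; last first.
  by rewrite ltnNge (leqW im) /= subSn //; apply: Cs; lia.
case: ltnP => im1.
  split=> [x [c hc]|sub]; last by apply: (nSv (Ordinal im)); apply/sub/Sv.
  exists (fun j : 'I_m => if (j < i)%N then c j else 0).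
  move: hc; congr (U (_ - _)); apply: eq_bigr => j _; congr (_ *: _).
  by case: ltnP => ji; [rewrite leqW // ltnW|rewrite if_same].
have -> : (i.+1 - m = 0)%N by lia.
have [_ WC] := hC 0%N isT.
split=> [x /SW /WC//|sub].
by apply: (nSv (Ordinal im)); apply: sub; apply: WC.
Qed.

Lemma ideal_chain_truncation J t : homogeneous_ideal J ->
  ideal_chain_above (truncation J t) (\sum_(i < t) hilbert_fun J i)%N.
Proof.
move=> hom; elim: t => [|t IH].
  rewrite big_ord0; exists (fun=> @unit_ideal R); split=> // i _; split=> //.
rewrite big_ord_recr /= addnC.
apply: ideal_chain_extend (reldim_truncation t hom) IH; try exact: truncation_ideal.
  by move=> x; apply: truncationS.
by move=> i a; apply: truncationX.
Qed.

Lemma quotient_length_truncation J t l : homogeneous_ideal J ->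
  quotient_length (ideal_add J (ideal_exp M t)) l ->
  l = (\sum_(i < t) hilbert_fun J i)%N.
Proof.
move=> hom [[C [hC Cs]] lmax]; apply/eqP; rewrite eqn_leq; apply/andP; split.
  apply: (chain_length_le (truncation_ideal t hom) (reldim_truncation_sum t hom)).
  exists C; split=> // i /hC[hCi sub]; split=> // x hx.
  by apply: sub; apply/truncationE.
apply: lmax; have [C' [hC' Cs']] := ideal_chain_truncation t hom.
exists C'; split=> // i /hC'[hCi sub]; split=> // x hx.
by apply: sub; apply/truncationE.
Qed.

End Length.

(** * The multiplicity bound *)

Section PolynomialGrowth.
Implicit Types (p q w : {poly rat}).

Lemma lead_coef_ge0 w t0 :
  (forall t : nat, (t0 <= t)%N -> 0 <= w.[t%:R]) -> 0 <= lead_coef w.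
Proof.
move=> hw; rewrite leNgt; apply/negP => lc0.
have w0 : w != 0 by rewrite -lead_coef_eq0 lt_eqF.
have sw : (0 < size w)%N by rewrite size_poly_gt0.
pose m := (size w).-1; pose B := \sum_(i < m) `|w`_i|.
have B0 : 0 <= B by apply: sumr_ge0.
(* Beyond B / (- lead_coef w) the leading term outweighs all the others together. *)
pose t := maxn t0 (maxn 1 (Num.bound (B / - lead_coef w))).
have t1 : 1 <= t%:R :> rat by rewrite ler1n !leq_max orbT.
have tB : B < - lead_coef w * t%:R.
  rewrite mulrC -ltr_pdivrMr ?oppr_gt0 //.
  apply: lt_le_trans (archi_boundP _) _.
    by rewrite divr_ge0 // oppr_ge0 ltW.
  by rewrite ler_nat !leq_max leqnn !orbT.
have := hw t (leq_maxl _ _); rewrite leNgt => /negP; apply.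
rewrite horner_coef -(prednK sw) big_ord_recr /= -/m -lead_coefE.
have tm : 0 < t%:R ^+ m :> rat by rewrite exprn_gt0 // (lt_le_trans _ t1).
have le_sum : (\sum_(i < m) w`_i * t%:R ^+ i) * t%:R <= B * t%:R ^+ m.
  rewrite /B !mulr_suml; apply: ler_sum => i _; rewrite -mulrA -exprSr.
  apply: le_trans (_ : `|w`_i| * t%:R ^+ i.+1 <= _).
    by rewrite ler_wpM2r ?ler_norm // exprn_ge0 // (le_trans _ t1).
  by rewrite ler_wpM2l // ler_weXn2l.
have t0' : 0 < t%:R :> rat by apply: lt_le_trans t1.
rewrite -(pmulr_llt0 _ t0') mulrDl.
have : B * t%:R ^+ m < - lead_coef w * t%:R * t%:R ^+ m by rewrite ltr_pM2r.
lra.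
Qed.

Definition binomial_poly D : {poly rat} :=
  (D`!%:R)^-1 *: \prod_(i < D) ('X + (i.+1%:R)%:P).

Lemma binomial_poly_horner D (t : nat) : (binomial_poly D).[t%:R] = 'C(t + D, D)%:R.
Proof.
have f0 : D`!%:R != 0 :> rat by rewrite pnatr_eq0 -lt0n fact_gt0.
apply: (mulfI f0); rewrite hornerZ mulVKf // horner_prod -natrM.
under eq_bigr => i _ do rewrite hornerD hornerX hornerC -natrD.
rewrite -natr_prod; congr (_%:R); elim: D {f0} => [|D IH].
  by rewrite big_ord0 bin0.
rewrite big_ord_recr /= IH factS addnS [RHS]mulnAC -mul_bin_diag /=.
by rewrite [RHS]mulnC -mulnA; congr (_ * _)%N; rewrite mulnC.
Qed.

Lemma size_binomial_poly D : size (binomial_poly D) = D.+1.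
Proof.
rewrite size_scale ?invr_eq0 ?pnatr_eq0 -?lt0n ?fact_gt0 //.
by rewrite (eq_bigr (fun i : 'I_D => 'X - (- i.+1%:R)%:P)) => [|i _];
  rewrite ?polyCN ?opprK // size_prod_XsubC /index_enum -enumT size_enum_ord.
Qed.

Lemma lead_coef_binomial_poly D : lead_coef (binomial_poly D) = (D`!%:R)^-1.
Proof.
rewrite lead_coefZ (eq_bigr (fun i : 'I_D => 'X - (- i.+1%:R)%:P)) => [|i _].
  by rewrite (eqP (monic_prod_XsubC _ _ _)) mulr1.
by rewrite polyCN opprK.
Qed.

(** Both bounds have degree at most D in t, and the shift by [c] does not affect the coefficient of
    degree D. So [p] has degree D, and its coefficients can be compared there. *)
Lemma normalized_lead_coef_le D P r c t0 p :
  (forall t : nat, (t0 <= t)%N -> 'C(t + D, D)%:R <= p.[t%:R]) ->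
  (forall t : nat, (t0 <= t)%N ->
     p.[t%:R] + r%:R * 'C(t - c + D, D)%:R <= P%:R * 'C(t + D, D)%:R) ->
  ((size p).-1)`!%:R * lead_coef p <= P%:R - r%:R.
Proof.
move=> lo up; pose b := binomial_poly D; pose b' := b \Po ('X - c%:R%:P).
have bE (t : nat) : b.[t%:R] = 'C(t + D, D)%:R := binomial_poly_horner D t.
have sb : size b = D.+1 := size_binomial_poly D.
have lb : lead_coef b = (D`!%:R)^-1 := lead_coef_binomial_poly D.
have f0 : 0 < D`!%:R :> rat by rewrite ltr0n fact_gt0.
have sb' : size b' = D.+1 by rewrite size_comp_poly2 // size_XsubC.
have lb' : lead_coef b' = (D`!%:R)^-1.
  by rewrite lead_coef_comp ?size_XsubC // lead_coefXsubC expr1n mulr1.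
have b'E (t : nat) : (c <= t)%N -> b'.[t%:R] = 'C(t - c + D, D)%:R.
  by move=> ct; rewrite /b' horner_comp hornerXsubC -natrB.
clearbody b b'; pose q := P%:R *: b - r%:R *: b'.
have lc_qp : 0 <= lead_coef (q - p).
  apply: (@lead_coef_ge0 _ (maxn t0 c)) => t; rewrite geq_max => /andP[h1 h2].
  rewrite !(hornerD, hornerN, hornerZ) b'E // bE; have := up t h1; lra.
have lc_pb : 0 <= lead_coef (p - b).
  apply: (@lead_coef_ge0 _ t0) => t h1.
  by rewrite hornerD hornerN bE subr_ge0 lo.
have sq : (size q <= D.+1)%N.
  rewrite (leq_trans (size_polyD _ _)) // geq_max size_polyN.
  by rewrite !(leq_trans (size_scale_leq _ _)) // ?sb ?sb'.
(* A smaller degree makes [p - b] eventually negative; a larger one makes [q - p] so, the leading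
   coefficient of [p] being positive by [lc_pb]. *)
have sp : size p = D.+1.
  have [sp|sp|//] := ltngtP (size p) D.+1.
    move: lc_pb; rewrite -opprB lead_coefN lead_coefDl ?size_polyN ?sb //.
    by rewrite lb oppr_ge0 leNgt invr_gt0 f0.
  have : 0 < lead_coef p.
    rewrite lt_neqAle eq_sym lead_coef_eq0 -size_poly_eq0 (gtn_eqF (leq_trans _ sp)) //=.
    by move: lc_pb; rewrite lead_coefDl ?size_polyN ?sb.
  move: lc_qp; rewrite -opprB lead_coefN lead_coefDl ?size_polyN ?(leq_ltn_trans sq) //.
  by rewrite oppr_ge0 leNgt => /negbTE->.
have qD : q`_D = (P%:R - r%:R) / D`!%:R.
  rewrite coefB !coefZ mulrBl; congr (_ * _ - _ * _).
    by rewrite -lb lead_coefE sb.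
  by rewrite -lb' lead_coefE sb'.
have : p`_D <= q`_D.
  have sqp : (size (q - p)%R <= D.+1)%N.
    by rewrite (leq_trans (size_polyD _ _)) // geq_max size_polyN sp sq /=.
  rewrite -subr_ge0 -coefB; case: (ltngtP (size (q - p)) D.+1) sqp => // s _.
    by rewrite nth_default.
  by move: lc_qp; rewrite lead_coefE s.
by rewrite qD lead_coefE sp /= ler_pdivlMr // mulrC.
Qed.

End PolynomialGrowth.

(** * Two-sided bounds on summed Hilbert functions *)

Section Bound.
Variables (k : fieldType) (n : nat).
Hypothesis hk : [pchar k] =i pred0.
Notation R := {mpoly k[n]}.
Implicit Types (s : seq (nat * R)) (f g : R).

(** The shifts in the series of [s] are bounded by unshifted terms, and the r shifts from the colon
    ideal are all replaced by the later shift d + r; neither change affects leading coefficients. *)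
Lemma hilbert_sum_upper s f d t : regular_forms s -> ~ gen (forms s) 1 ->
  f \is d.-homog -> ~ gen (forms s) f ->
  let r := (socle_degree s - d).+1 in let D := (n - size s)%N in (d + r <= t)%N ->
  (\sum_(i < t.+1) hilbert_fun (gen (forms ((d, f) :: s))) i
     + r * 'C(t - (d + r) + D, D) <= (\prod_(x <- s) x.1) * 'C(t + D, D))%N.
Proof.
move=> hs n1 hf nf r D ht.
have [E sE hE] := hilbert_fun_shifts hs (regular_forms_size_le hs n1).
have simplE i : 'C(i + D, D) = simplicial D.+1 i by [].
rewrite !simplE.
have : (\sum_(i < t.+1) hilbert_fun (gen (forms s)) i <= (\prod_(x <- s) x.1) * simplicial D.+1 t)%N.
  under [X in (X <= _)%N]eq_bigr => i _ do rewrite hE.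
  rewrite exchange_big /= -sE -(sum1_size E) big_distrl /=; apply: leq_sum => e _.
  rewrite sum_shift_simplicial mul1n /shift; case: ifP => // _.
  by apply: simplicial_mono; apply: leq_subr.
apply: leq_trans.
have hom := regular_forms_homogeneous hs.
under [X in (_ <= X)%N]eq_bigr => i _ do rewrite (hilbert_fun_add_principal i hom hf).
rewrite big_split leq_add2l.
have -> : (\sum_(i < t.+1) (if d <= i then hilbert_fun (ideal_colon (gen (forms s)) f) (i - d) else 0) =
    \sum_(i < t.+1) shift d (hilbert_fun (ideal_colon (gen (forms s)) f)) i)%N by [].
rewrite sum_shift /shift ifT; last by lia.
apply: (@leq_trans (\sum_(j < (t - d).+1) \sum_(i < r) shift i (simplicial D) j)%N); last first.
  by apply: leq_sum => j _; apply: hilbert_fun_colon_ge.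
rewrite exchange_big /= -[X in (X * _)%N]card_ord -sum_nat_const.
apply: leq_sum => i _; rewrite sum_shift_simplicial /shift.
have ir := ltn_ord i; rewrite ifT; last by lia.
by apply: simplicial_mono; lia.
Qed.

Lemma hilbert_sum_lower s g d (I : R -> Prop) t : regular_forms s -> g \is d.-homog ->
  ~ gen (forms s) g -> is_ideal I -> ideal_sub I (ideal_colon (gen (forms s)) g) ->
  ('C(t + (n - size s), n - size s) <= \sum_(i < t.+1) hilbert_fun I i)%N.
Proof.
move=> hs hg ng hI sub; rewrite -[X in (X <= _)%N]/(simplicial (n - size s).+1 t).
rewrite -sum_simplicial; apply: leq_sum => i _.
apply: leq_trans (hilbert_fun_mono i hI (colon_ideal g (gen_ideal _)) sub).
(* The summand of index 0 alone has the required growth. *)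
apply: leq_trans (hilbert_fun_colon_ge hk i hs hg ng).
by rewrite big_ord_recl /= /shift subn0 leq_addr.
Qed.

End Bound.

(** * From indexed families to lists of forms *)

Lemma ideal_gen_is_ideal (A : comNzRingType) m (f : 'I_m -> A) (S : pred 'I_m) :
  is_ideal (ideal_gen f S).
Proof.
split=> [|a b [x ->] [y ->]|a b [y ->]].
- by exists (fun=> 0); rewrite big1 // => i _; rewrite mul0r.
- by exists (fun i => x i + y i); rewrite -big_split; apply: eq_bigr => i _; rewrite mulrDl.
- by exists (fun i => a * y i); rewrite mulr_sumr; apply: eq_bigr => i _; rewrite mulrA.
Qed.

Lemma ideal_genE (A : comNzRingType) m (f : 'I_m -> A) (S : pred 'I_m) (s : seq A) :
  (forall i, S i -> f i \in s) -> (forall x, x \in s -> exists2 i, S i & x = f i) ->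
  forall a, ideal_gen f S a <-> gen s a.
Proof.
move=> h1 h2 a; split=> [[c ->]|].
  have hs := gen_ideal s; apply: ideal_sum => // i Si.
  by apply: idealMl => //; apply/gen_mem/h1.
apply: gen_min; first exact: ideal_gen_is_ideal.
move=> x /h2[i Si ->]; exists (fun j => (j == i)%:R).
by rewrite (bigD1 i) //= eqxx mul1r big1 ?addr0 // => j /andP[_ /negbTE->]; rewrite mul0r.
Qed.

Lemma hilbert_fun_ext (k : fieldType) n (c c' : {mpoly k[n]} -> Prop) j :
  is_ideal c -> is_ideal c' -> (forall a, c a <-> c' a) -> hilbert_fun c j = hilbert_fun c' j.
Proof.
move=> hc hc' cc'; apply/eqP; rewrite eqn_leq.
by rewrite !hilbert_fun_mono // => x /cc'.
Qed.

Section InitialForms.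
Variables (k : fieldType) (n N : nat).
Variables (f : 'I_N.+1 -> {mpoly k[n]}) (d : 'I_N.+1 -> nat).
Hypotheses (hf : forall i, f i \is (d i).-homog)
  (hreg : regular_sequence (init_family f)).

(** Listed backwards because [regular_forms] has the last form at its head; [inord] spares the
    recursion a bound on [m]. *)
Fixpoint initial_forms m : seq (nat * {mpoly k[n]}) :=
  if m is m'.+1 then (d (inord m'), f (inord m')) :: initial_forms m' else [::].

Lemma inord_widen (i : 'I_N) : inord i = widen_ord (leqnSn N) i.
Proof. by apply: val_inj; rewrite /= inordK // ltnS ltnW. Qed.

Lemma big_initial_forms (T : Type) (idx : T) (op : Monoid.com_law idx) F m :
  \big[op/idx]_(x <- initial_forms m) F x =
    \big[op/idx]_(i < m) F (d (inord i), f (inord i)).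
Proof.
elim: m => [|m IH]; first by rewrite big_nil big_ord0.
by rewrite big_cons big_ord_recr /= IH Monoid.mulmC.
Qed.

Lemma mem_initial_forms m x :
  x \in forms (initial_forms m) <-> exists2 i, (i < m)%N & x = f (inord i).
Proof.
elim: m => [|m IH]; first by split=> // -[].
rewrite inE; split=> [/orP[/eqP->|/IH[i im ->]]|[i]]; first by exists m.
  by exists i => //; apply: ltnW.
rewrite ltnS leq_eqVlt => /orP[/eqP-> ->|im xi]; first by rewrite eqxx.
by apply/orP; right; apply/IH; exists i.
Qed.

Lemma gen_initial_forms m a : (m <= N)%N ->
  ideal_gen (init_family f) [pred j : 'I_N | (j < m)%N] a <-> gen (forms (initial_forms m)) a.
Proof.
move=> mN; apply: ideal_genE => [i im|x /mem_initial_forms[i im ->]].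
  by apply/mem_initial_forms; exists (val i); rewrite // inord_widen.
exists (Ordinal (leq_trans im mN)) => //=.
by rewrite /init_family -inord_widen.
Qed.

Lemma gen_all_initial_forms a :
  ideal_gen (init_family f) predT a <-> gen (forms (initial_forms N)) a.
Proof.
rewrite -gen_initial_forms //; split=> -[c ->]; exists c; apply: eq_bigl => i /=;
  by rewrite ltn_ord.
Qed.

Lemma regular_initial_forms m : (m <= N)%N -> regular_forms (initial_forms m).
Proof.
elim: m => // m IH mN.
have nf a : gen (forms (initial_forms m)) (a * f (inord m)) -> gen (forms (initial_forms m)) a.
  move/(gen_initial_forms _ (ltnW mN)) => h; apply/(gen_initial_forms _ (ltnW mN)).
  have [reg _] := hreg; apply: (reg (Ordinal mN)).
  by rewrite /init_family -inord_widen.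
split; [exact: hf| |exact: IH (ltnW mN)|exact: nf].
(* A form of degree 0 is a constant. If it is 0, regularity puts 1 in the ideal; if not, it is a
   unit. Either way the ideal is improper. *)
rewrite lt0n; apply/eqP => /= d0; have := hf (inord m); rewrite d0 => /homog0_const.
set c := _@_0 => fc; have [_ []] := hreg; apply/gen_all_initial_forms.
have sub i : (i <= N)%N -> ideal_sub (gen (forms (initial_forms i))) (gen (forms (initial_forms N))).
  move=> iN x; apply: gen_subset => y /mem_initial_forms[l li ->].
  by apply/mem_initial_forms; exists l => //; apply: leq_trans iN.
have [c0|c0] := eqVneq c 0.
  apply: (sub m (ltnW mN)); apply: nf.
  by rewrite fc c0 mpolyC0 mulr0; apply: ideal0 (gen_ideal _).
apply: (sub m.+1 mN).
have -> : 1 = c^-1%:MP * f (inord m) by rewrite fc -mpolyCM mulVf.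
by apply: idealMl (gen_ideal _) _; apply: gen_mem; rewrite /= mem_head.
Qed.

End InitialForms.

Theorem theorem1 (k : fieldType) (hk : [pchar k] =i pred0) (n N : nat)
  (f : 'I_N.+1 -> {mpoly k[n]}) (d : 'I_N.+1 -> nat)
  (hf : forall i, f i \is (d i).-homog)
  (hreg : regular_sequence (init_family f))
  (haci : almost_complete_intersection f)
  (hht : ideal_height (ideal_gen f predT) N)
  (hmin : minimal_generators f)
  (e : rat) (he : multiplicity (ideal_gen f predT) e) :
  e <= \prod_(i < N) (d (widen_ord (leqnSn N) i))%:R
       - Num.max 1 (\sum_(i < N) ((d (widen_ord (leqnSn N) i))%:R - 1)
                    - ((d ord_max)%:R - 1)).
Proof.
pose s := initial_forms f d N; pose c := gen (forms s).
pose h := f ord_max; pose dh := d ord_max.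
have cE a : ideal_gen (init_family f) predT a <-> c a := gen_all_initial_forms f d a.
have hs : regular_forms s := regular_initial_forms hf hreg (leqnn N).
have c1 : ~ c 1 by move=> /cE; case: hreg.
have hc : is_ideal c := gen_ideal _.
have hom : homogeneous_ideal c := regular_forms_homogeneous hs.
have hh : h \is dh.-homog := hf ord_max.
have [_ _ [_ nsub] [_ nsub']] := haci.
have ch : ~ c h.
  by move=> cch; apply: nsub' => a _; rewrite /ideal_colon; apply/cE; apply: idealMl.
(* A homogeneous component of an element of (c : h) outside [c]; it serves to bound the Hilbert
   function of R/I from below. *)
have [g [e' [hg cg cgh]]] : exists g e', [/\ g \is e'.-homog, ~ c g & c (g * h)].
  apply: NNPP => no; apply: nsub => a /cE cah; apply/cE.
  apply: (hpart_mem hom) => e'; apply: NNPP => na; apply: no.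
  exists (pihomog mdeg e' a), e'; split=> //; first exact: pihomogP.
  by have [_ h1] := colon_homogeneous hom hh; apply: h1.
have formsE x l : forms (x :: l) = x.2 :: forms l :> seq {mpoly k[n]} by [].
pose I := ideal_gen f predT; pose I' := gen (forms ((dh, h) :: s)).
have II' a : I a <-> I' a.
  apply: ideal_genE => [i _|x].
    case: (unliftP ord_max i) => [j ->|->]; last exact: mem_head.
    have -> : lift ord_max j = inord j.
      by rewrite inord_widen; apply: val_inj; rewrite /= /bump leqNgt ltn_ord.
    by rewrite formsE inE; apply/orP; right; apply/mem_initial_forms;
      exists (val j); [exact: (ltn_ord j)|].
  rewrite formsE inE => /orP[/eqP->|/mem_initial_forms[i _ ->]].
    by exists ord_max.
  by exists (inord i).
have hI : is_ideal I := ideal_gen_is_ideal f predT.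
have hI' : is_ideal I' := gen_ideal _.
have homI : homogeneous_ideal I.
  split=> // a r /II' ha; apply/II'.
  suff [_ h1] : homogeneous_ideal I' by apply: h1.
  apply: gen_homogeneous => y; rewrite formsE inE => /orP[/eqP->|/mem_initial_forms[i _ ->]].
    by exists dh.
  by exists (d (inord i)).
have Isub : ideal_sub I (ideal_colon c g).
  move=> a /II'; apply: gen_min; first exact: colon_ideal.
  move=> y; rewrite formsE inE => /orP[/eqP->|ys]; first by rewrite /ideal_colon mulrC.
  by apply: idealMr => //; apply: gen_mem.
have [p [[t0 hp] ->]] := he.
have pE t : (t0 <= t)%N -> p.[t%:R] = (\sum_(i < t.+1) hilbert_fun I i)%:R.
  by move=> /hp[l [/(quotient_length_truncation homI)<- ->]].
pose w := widen_ord (leqnSn N).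
have dpos (i : 'I_N) : (0 < d (w i))%N.
  by have [_ + _ _] := regular_initial_forms hf hreg (ltn_ord i); rewrite /= inord_widen.
have sumE : socle_degree s = (\sum_(i < N) (d (w i)).-1)%N.
  by rewrite /socle_degree big_initial_forms; apply: eq_bigr => i _; rewrite inord_widen.
have prodE : (\prod_(x <- s) x.1 = \prod_(i < N) d (w i))%N.
  by rewrite big_initial_forms; apply: eq_bigr => i _; rewrite inord_widen.
set D := (n - size s)%N; set r := (socle_degree s - dh).+1.
have /le_trans -> // : ((size p).-1)`!%:R * lead_coef p <= (\prod_(x <- s) x.1)%N%:R - r%:R.
  (* [t0] is the threshold of the polynomial [p], and dh + r is the one demanded by
     [hilbert_sum_upper]. *)
  apply: (@normalized_lead_coef_le D _ r (dh + r) (maxn t0 (dh + r))) => t;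
    rewrite geq_max => /andP[t1 t2]; rewrite pE //.
    by rewrite ler_nat; apply: (hilbert_sum_lower hk _ hs hg cg hI Isub).
  rewrite -!natrM -natrD ler_nat.
  have -> : (\sum_(i < t.+1) hilbert_fun I i = \sum_(i < t.+1) hilbert_fun I' i)%N.
    by apply: eq_bigr => i _; apply: hilbert_fun_ext.
  exact: (hilbert_sum_upper hk hs c1 hh ch t2).
(* By truncated subtraction [r] is at least 1 and at least [socle_degree s] - dh + 1, the two
   entries of the maximum. *)
rewrite prodE natr_prod lerD2l lerN2 ge_max ler1n /=.
have -> : \sum_(i < N) ((d (w i))%:R - 1) = (socle_degree s)%:R :> rat.
  by rewrite sumE natr_sum; apply: eq_bigr => i _; rewrite -subn1 natrB.
have : (socle_degree s)%:R + 1 <= r%:R + dh%:R :> rat.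
  by rewrite natr1 -natrD ler_nat /r; lia.
rewrite /dh; lra.
Qed.
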